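(* Let $u\in\mathcal U$ be an admissible control, let $u^*\in\mathcal U$ be the optimal control, and let $\delta=u^*-u$. Then the relative error $r(u)$ satisfies $$r(u)\le\left(\mathbb E\left[\exp\left((1+\sqrt2)^2\int_0^T|\delta(X_s^u,s)|^2\,\mathrm ds\right)\right]^{\frac1{1+\sqrt2}}-1\right)^{\frac12}.$$
   Context: Setting. Let $0<T<\infty$, $b:\mathbb R^d\times[0,T]\to\mathbb R^d$, $\sigma:\mathbb R^d\times[0,T]\to\mathbb R^{d\times d}$ with $\sigma(x,s)$ invertible, $x_{\mathrm{init}}\in\mathbb R^d$ deterministic, $W$ a standard $d$-dimensional Brownian motion, and let $X$ solve $\mathrm dX_s=b(X_s,s)\,\mathrm ds+\sigma(X_s,s)\,\mathrm dW_s$, $X_0=x_{\mathrm{init}}$, on $[0,T]$. For given $f:\mathbb R^d\times[0,T]\to\mathbb R$ and $g:\mathbb R^d\to\mathbb R$ set $\mathcal W(X)=\int_0^T f(X_s,s)\,\mathrm ds+g(X_T)$ and $\mathcal Z=\mathbb E[e^{-\mathcal W(X)}]$, assumed finite. For a control $u:\mathbb R^d\times[0,T]\to\mathbb R^d$ let $X^u$ solve $\mathrm dX^u_s=\left(b(X^u_s,s)+\sigma(X^u_s,s)u(X^u_s,s)\right)\mathrm ds+\sigma(X^u_s,s)\,\mathrm dW_s$, $X^u_0=x_{\mathrm{init}}$. Let $\mathbb P$ and $\mathbb P^u$ be the laws of $X$ and $X^u$ on the path space $\mathcal C$ of continuous functions $[0,T]\to\mathbb R^d$ starting at $x_{\mathrm{init}}$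 (Borel $\sigma$-algebra of the supremum norm). All coefficients are measurable and the uncontrolled SDE is well posed. $\mathcal U$ denotes the set of admissible (measurable) controls, i.e. those for which the controlled SDE has a unique strong solution, and $\mathbb P$ and $\mathbb P^u$ are equivalent with Girsanov density $$\frac{\mathrm d\mathbb P^u}{\mathrm d\mathbb P}(X)=\exp\left(\int_0^T(u^\top\sigma^{-1})(X_s,s)\cdot\mathrm dX_s-\int_0^T(\sigma^{-1}b\cdot u)(X_s,s)\,\mathrm ds-\frac12\int_0^T|u(X_s,s)|^2\,\mathrm ds\right).$$ The optimal control $u^*\in\mathcal U$ is assumed to exist and is characterized by $\mathbb P^{u^*}=\mathbb Q$, where $\frac{\mathrm d\mathbb Q}{\mathrm d\mathbb P}=\frac{e^{-\mathcal W}}{\mathcal Z}$. The relative error is $r(u)=\frac1{\mathcal Z}\sqrt{\operatorname{Var}\left(e^{-\mathcal W(X^u)}\frac{\mathrm d\mathbb P}{\mathrm d\mathbb P^u}(X^u)\right)}\in[0,\infty]$. The right-hand side of the claimed bound may be $+\infty$. *)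

(* Defs.v *)
From HB Require Import structures.
From mathcomp Require Import all_boot all_order all_algebra.
From mathcomp Require Import all_classical all_reals all_analysis.

Set Implicit Arguments.
Unset Strict Implicit.
Unset Printing Implicit Defensive.

Import Order.TTheory GRing.Theory Num.Theory.
Import numFieldTopology.Exports numFieldNormedType.Exports.

Local Open Scope classical_set_scope.
Local Open Scope ring_scope.

(* R^d is 'cV[R]_d.  Vectors and matrices carry the Borel sigma-algebra of
   their usual topology. *)
HB.instance Definition _ (R : realType) (m n : nat) :=
  Measurable.copy 'M[R]_(m, n) (g_sigma_algebraType (@open 'M[R]_(m, n))).

Definition sqnorm (R : realType) (d : nat) (v : 'cV[R]_d) : R :=
  \sum_(i < d) v i 0 ^+ 2.

(* The space of continuous functions [0, T] -> R^d starting at x0.  Such a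
   function is represented by its unique extension to the real line that is
   constant on each side of [0, T]. *)
Definition is_cpath (R : realType) (d : nat) (T : R) (x0 : 'cV[R]_d)
    (x : R -> 'cV[R]_d) : Prop :=
  [/\ continuous x, x 0 = x0 &
      forall t, x t = x (Num.max 0 (Num.min t T))].

Record cpath (R : realType) (d : nat) (T : R) (x0 : 'cV[R]_d) :=
  CPath { cpath_fun :> R -> 'cV[R]_d ; cpath_funP : is_cpath T x0 cpath_fun }.

Lemma cst_is_cpath (R : realType) (d : nat) (T : R) (x0 : 'cV[R]_d) :
  is_cpath T x0 (fun=> x0).
Proof. by split => //; exact: cst_continuous. Qed.

HB.instance Definition _ (R : realType) (d : nat) (T : R) (x0 : 'cV[R]_d) :=
  gen_eqMixin (cpath T x0).
HB.instance Definition _ (R : realType) (d : nat) (T : R) (x0 : 'cV[R]_d) :=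
  gen_choiceMixin (cpath T x0).
HB.instance Definition _ (R : realType) (d : nat) (T : R) (x0 : 'cV[R]_d) :=
  isPointed.Build (cpath T x0) (CPath (cst_is_cpath T x0)).

(* Open sets of the supremum norm on [0, T], i.e. of uniform convergence. *)
Definition sup_open (R : realType) (d : nat) (T : R) (x0 : 'cV[R]_d) :
    set (set (cpath T x0)) :=
  [set (@cpath_fun R d T x0) @^-1` O
    | O in (@open {uniform` `[0, T] -> 'cV[R]_d})].

HB.instance Definition _ (R : realType) (d : nat) (T : R) (x0 : 'cV[R]_d) :=
  Measurable.copy (cpath T x0) (g_sigma_algebraType (sup_open (T:=T) (x0:=x0))).

Section stochastic_calculus.
Context {dO : measure_display} {Omega : measurableType dO} {R : realType}
  (P : probability Omega R) {d : nat}.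

Definition measurable_wrt {dU : measure_display} {U : measurableType dU}
    (G : set (set Omega)) (Y : Omega -> U) : Prop :=
  forall B, measurable B -> G (Y @^-1` B).

Definition natural_filtration (W : R -> Omega -> 'cV[R]_d) (t : R) :
    set (set Omega) :=
  <<s \bigcup_(s in `[0, t]) [set W s @^-1` B | B in measurable] >>.

Definition augmented_filtration (W : R -> Omega -> 'cV[R]_d) (t : R) :
    set (set Omega) :=
  <<s natural_filtration W t `|` [set N | measurable N /\ P N = 0%E] >>.

(* The last clause says that the coordinates of W t - W s are independent of
   one another and of the past up to s, each with law N(0, t - s). *)
Definition brownian_motion (T : R) (W : R -> Omega -> 'cV[R]_d) : Prop :=
  [/\ forall t, 0 <= t <= T -> measurable_fun setT (W t),
      {ae P, forall w, W 0 w = 0},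
      {ae P, forall w, {within `[0, T], continuous (W ^~ w)}} &
      forall s t, 0 <= s -> s < t -> t <= T ->
      forall (A : set Omega) (B : 'I_d -> set R),
        natural_filtration W s A -> (forall i, measurable (B i)) ->
        (P (A `&` [set w | forall i, B i (W t w i 0%R - W s w i 0%R)%R]) =
         P A * \prod_(i < d) normal_prob 0 (Num.sqrt (t - s)) (B i))%E].

Definition cvg0_in_probability (Y : nat -> Omega -> \bar R) : Prop :=
  forall e : R, 0 < e -> P [set w | (e%:E <= Y n w)%E] @[n --> \oo] --> 0%E.

(* The process \sum_(k < n) H_k 1_]t_k, t_(k+1)]. *)
Record simple_process := SimpleProcess {
  sp_size : nat ;
  sp_time : nat -> R ;
  sp_coef : nat -> Omega -> 'rV[R]_d }.

Definition is_simple (F : R -> set (set Omega)) (t : R) (S : simple_process) :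
    Prop :=
  [/\ 0 <= sp_time S 0%N,
      forall k, (k < sp_size S)%N -> sp_time S k <= sp_time S k.+1,
      sp_time S (sp_size S) <= t,
      forall k, (k < sp_size S)%N ->
        measurable_wrt (F (sp_time S k)) (sp_coef S k) &
      exists M : R, forall k w i, (k < sp_size S)%N ->
        `|sp_coef S k w 0 i| <= M].

Definition sp_val (S : simple_process) (s : R) (w : Omega) : 'rV[R]_d :=
  \sum_(k < sp_size S | sp_time S k < s <= sp_time S k.+1) sp_coef S k w.

Definition sp_int (W : R -> Omega -> 'cV[R]_d) (S : simple_process)
    (w : Omega) : R :=
  \sum_(k < sp_size S)
    (sp_coef S k w *m (W (sp_time S k.+1) w - W (sp_time S k) w)) 0 0.

(* I is (a version of) the Ito integral of H against W over [0, t]: the limit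
   in probability of the integrals of simple processes S n such that the
   integral of |S n - H|^2 over [0, t] tends to 0 in probability. *)
Definition ito_integral (W : R -> Omega -> 'cV[R]_d) (t : R)
    (H : R -> Omega -> 'rV[R]_d) (I : Omega -> R) : Prop :=
  [/\ measurable_fun (`[0, t] `*` setT) (fun p : R * Omega => H p.1 p.2),
      forall s, 0 <= s <= t -> measurable_wrt (augmented_filtration W s) (H s),
      measurable_fun setT I &
      exists S : nat -> simple_process,
      [/\ forall n, is_simple (augmented_filtration W) t (S n),
          cvg0_in_probability (fun n w =>
            \int[lebesgue_measure]_(s in `[0%R, t])
              (sqnorm (sp_val (S n) s w - H s w)^T%R)%:E)%E &
          cvg0_in_probability (fun n w => (`|sp_int W (S n) w - I w|)%:E)]].

End stochastic_calculus.

Section sde.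
Context {dO : measure_display} {Omega : measurableType dO} {R : realType}
  (P : probability Omega R) {d : nat} (T : R) (x0 : 'cV[R]_d)
  (b : 'cV[R]_d -> R -> 'cV[R]_d) (sigma : 'cV[R]_d -> R -> 'M[R]_d)
  (W : R -> Omega -> 'cV[R]_d).

Definition measurable_coef (m n : nat) (a : 'cV[R]_d -> R -> 'M[R]_(m, n)) :
    Prop :=
  measurable_fun (setT `*` `[0, T]) (fun p : 'cV[R]_d * R => a p.1 p.2).

(* dX = beta(X, s) ds + sigma(X, s) dW, X_0 = x0 on [0, T], coordinatewise and
   with X adapted to the augmented filtration of W. *)
Definition strong_solution (beta : 'cV[R]_d -> R -> 'cV[R]_d)
    (X : {mfun Omega >-> cpath T x0}) : Prop :=
  [/\ forall t, 0 <= t <= T ->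
        measurable_wrt (augmented_filtration P W t) (fun w => X w t),
      forall i, {ae P, forall w, lebesgue_measure.-integrable `[0, T]
                  (fun s => (beta (X w s) s i 0)%:E)} &
      forall t i, 0 <= t <= T ->
        ito_integral P W t (fun s w => row i (sigma (X w s) s))
          (fun w => X w t i 0 - x0 i 0 -
             (\int[lebesgue_measure]_(s in `[0, t]) beta (X w s) s i 0))].

Definition unique_strong_solution (beta : 'cV[R]_d -> R -> 'cV[R]_d) : Prop :=
  (exists X, strong_solution beta X) /\
  forall X Y, strong_solution beta X -> strong_solution beta Y ->
    {ae P, forall w, forall t, 0 <= t <= T -> X w t = Y w t}.

Definition controlled_drift (u : 'cV[R]_d -> R -> 'cV[R]_d)
    (x : 'cV[R]_d) (s : R) : 'cV[R]_d := b x s + sigma x s *m u x s.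

(* I is the integral over [0, T] of Y . dX, where X solves
   dX = b(X, s) ds + sigma(X, s) dW. *)
Definition integral_dX (X : {mfun Omega >-> cpath T x0})
    (Y : R -> Omega -> 'rV[R]_d) (I : Omega -> R) : Prop :=
  {ae P, forall w, lebesgue_measure.-integrable `[0, T]
    (fun s => ((Y s w *m b (X w s) s) 0 0)%:E)} /\
  exists2 J : Omega -> R,
    ito_integral P W T (fun s w => Y s w *m sigma (X w s) s) J &
    {ae P, forall w, I w =
      (\int[lebesgue_measure]_(s in `[0, T]) (Y s w *m b (X w s) s) 0 0) +
      J w}.

Local Open Scope charge_scope.

Definition density {dC : measure_display} {C : measurableType dC}
    (nu mu : probability C R) (x : C) : R :=
  fine (('d (charge_of_finite_measure nu) '/d mu) x).

(* The existence of the dX-integral I forces both ds-integrals of the exponent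
   to be finite almost surely. *)
Definition girsanov_density (u : 'cV[R]_d -> R -> 'cV[R]_d)
    (X Xu : {mfun Omega >-> cpath T x0}) : Prop :=
  exists2 I : Omega -> R,
    integral_dX X (fun s w => (u (X w s) s)^T *m invmx (sigma (X w s) s)) I &
    {ae P, forall w, density (distribution P Xu) (distribution P X) (X w) =
      expR (I w
        - (\int[lebesgue_measure]_(s in `[0, T])
             ((invmx (sigma (X w s) s) *m b (X w s) s)^T *m u (X w s) s) 0 0)
        - 2^-1 * (\int[lebesgue_measure]_(s in `[0, T])
             sqnorm (u (X w s) s)))}.

(* X is the solution of the uncontrolled equation, so that
   distribution P X and distribution P Xu are the path measures P and P^u. *)
Definition admissible (X : {mfun Omega >-> cpath T x0})
    (u : 'cV[R]_d -> R -> 'cV[R]_d) : Prop :=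
  [/\ measurable_coef u,
      unique_strong_solution (controlled_drift u) &
      forall Xu, strong_solution (controlled_drift u) Xu ->
        [/\ distribution P Xu `<< distribution P X,
            distribution P X `<< distribution P Xu &
            girsanov_density u X Xu]].

(* The Lebesgue integral is 0 when it is undefined or infinite; f is not assumed
   integrable along paths. *)
Definition work (f : 'cV[R]_d -> R -> R) (g : 'cV[R]_d -> R)
    (x : cpath T x0) : R :=
  (\int[lebesgue_measure]_(s in `[0, T]) f (x s) s) + g (x T).

Definition partition_function (f : 'cV[R]_d -> R -> R) (g : 'cV[R]_d -> R)
    (X : {mfun Omega >-> cpath T x0}) : \bar R :=
  'E_P[fun w => expR (- work f g (X w))]%E.

(* The law of Xs is the measure Q with dQ/dP = exp(-W)/Z on path space. *)
Definition optimal (f : 'cV[R]_d -> R -> R) (g : 'cV[R]_d -> R)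
    (X Xs : {mfun Omega >-> cpath T x0}) : Prop :=
  forall A : set (cpath T x0), measurable A ->
    distribution P Xs A =
    (\int[distribution P X]_(x in A)
       (expR (- work f g x) / fine (partition_function f g X))%:E)%E.

Definition relative_error (f : 'cV[R]_d -> R -> R) (g : 'cV[R]_d -> R)
    (X Xu : {mfun Omega >-> cpath T x0}) : \bar R :=
  ((fine (partition_function f g X))^-1%:E *
   sqrte 'V_P[fun w => (expR (- work f g (Xu w)) *
     density (distribution P X) (distribution P Xu) (Xu w))%R])%E.

End sde.

(* Main.v *)
Require Import Defs.
From HB Require Import structures.
From mathcomp Require Import all_boot all_order all_algebra.
From mathcomp Require Import all_classical all_reals all_analysis.
From mathcomp Require Import measurable_realfun ring lra.

Set Implicit Arguments.
Unset Strict Implicit.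
Unset Printing Implicit Defensive.

Import Order.TTheory GRing.Theory Num.Theory.
Import numFieldTopology.Exports numFieldNormedType.Exports.

Local Open Scope classical_set_scope.
Local Open Scope ring_scope.

(** Write mu, nu, rho for the laws on path space of the uncontrolled, the
controlled and the optimally controlled solution, and L = drho/dnu.  Since rho
has density exp (- work) / Z with respect to mu, the weight whose variance is
taken is Z * L, so the squared relative error is the second moment of L under
nu minus 1 (lemmas second_moment_variance and relative_sd_le).

Let delta be the difference of the two controls and Lam the integral of
|delta|^2 along the path.  By Girsanov, L is the exponential of M - Lam / 2 where
M is the stochastic integral of delta along the controlled path, so
L^2 = exp (2 M - 2 p Lam) * exp ((2 p - 1) Lam), and Hoelder with conjugate
exponents p and q bounds the second moment of L by
  E[exp (2 p M - 2 p^2 Lam)]^(1/p) * E[exp (q (2 p - 1) Lam)]^(1/q)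
(lemma second_moment_hoelder).  The first factor is the expectation of a
stochastic exponential, hence at most 1.  Minimizing q (2 p - 1) gives
p = 1 + 1 / sqrt 2, q = 1 + sqrt 2 and q (2 p - 1) = (1 + sqrt 2)^2.

The first factor is estimated along the uncontrolled path X, to which the
expectation is transported by multiplying with dnu/dmu: there it becomes
E[(dnu/dmu)^al (drho/dmu)^be exp (al be Lam / 2)] with al = 1 - 2 p and
be = 2 p, and inserting the two Girsanov formulas along X turns the integrand
into the stochastic exponential of al u + be us (lemma tilted_moment_le1,
through the identity sqnorm_affine, valid because al + be = 1).

That stochastic exponentials have expectation at most 1 (ito_exponential_le1) is
proved from the definition of the Ito integral.  For simple integrands the
expectation is exactly 1: on a grid refining the partitions of the two simple
processes the exponential is a product of factors exp (h . dW - |h|^2 dt / 2)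
with h known at the left endpoint, and each factor integrates to 1 because the
Brownian increment is a Gaussian vector independent of the past
(integral_exp_normal_vec, simple_exponential).  For general integrands,
approximating simple processes converge almost surely along a subsequence, and
Fatou's lemma concludes.

Evaluation of paths is jointly measurable in path and time, which makes the work
and Lam measurable on path space (measurable_cpath_apply). *)

(** * Integration against a density, and freezing *)

Section density.
Context d (T : measurableType d) (R : realType).
Local Open Scope ereal_scope.

Lemma ge0_integral_density (mu : {sigma_finite_measure set T -> \bar R})
    (nu : {finite_measure set T -> \bar R}) (h f : T -> \bar R) :
  measurable_fun setT h -> (forall x, 0 <= h x) ->
  (forall A, measurable A -> nu A = \int[mu]_(x in A) h x) ->
  measurable_fun setT f -> (forall x, 0 <= f x) ->
  \int[nu]_x f x = \int[mu]_x (f x * h x).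
Proof.
move=> mh h0 nuE mf f0.
have numu : nu `<< mu.
  apply/null_content_dominatesP => A mA A0; rewrite nuE//.
  by apply: null_set_integral => //; exact: measurable_funTS.
have hi : mu.-integrable setT h.
  apply/integrableP; split => //.
  under eq_integral do rewrite gee0_abs//.
  by rewrite -nuE// ltey_eq fin_num_measure.
rewrite -(Radon_Nikodym_SigmaFinite.change_of_variables numu)//.
apply: ae_eq_integral => //.
- apply: emeasurable_funM => //.
  exact: measurable_int (Radon_Nikodym_SigmaFinite.f_integrable numu).
- exact: emeasurable_funM.
suff : ae_eq mu setT h (Radon_Nikodym_SigmaFinite.f nu mu).
  by apply: filterS => x /(_ I) + _ => ->.
apply: integral_ae_eq => //.
  exact: measurable_int (Radon_Nikodym_SigmaFinite.f_integrable numu).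
move=> E _ mE; rewrite -nuE//.
by rewrite -Radon_Nikodym_SigmaFinite.f_integral.
Qed.

End density.

(** Completing the square turns the integrand into the Gaussian density of mean
h s^2 and the same variance. *)
Lemma integral_normal_exp_martingale (R : realType) (s h : R) : s != 0 ->
  (\int[normal_prob 0 s]_y (expR (h * y - 2^-1 * h ^+ 2 * s ^+ 2))%:E = 1)%E.
Proof.
move=> s0.
rewrite (@ge0_integral_density _ _ _ lebesgue_measure (normal_prob 0 s)
  (fun x => (normal_pdf 0 s x)%:E)) //=; first last.
- apply/measurable_EFinP; apply: measurableT_comp => //.
  by apply: measurable_funB => //; exact: measurable_funM.
- by move=> x; rewrite lee_fin normal_pdf_ge0.
- by apply/measurable_EFinP; exact: measurable_normal_pdf.
rewrite -(integral_normal_pdf (h * s ^+ 2) s); apply: eq_integral => x _.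
rewrite -EFinM; congr EFin; rewrite !normal_pdfE// mulrCA; congr (_ * _).
rewrite /normal_fun -expRD; congr expR; rewrite subr0.
by field.
Qed.

Section freezing.
Context d (T : measurableType d) (R : realType) (P : probability T R).
Variables (G : set (set T)) (Y : T -> measurableTypeR R)
  (gam : probability (measurableTypeR R) R).
Hypotheses (mG : G `<=` measurable) (GI : setI_closed G) (GT : G setT).
Hypothesis mY : measurable_fun setT Y.
Hypothesis indep : forall A B, G A -> measurable B ->
  P (A `&` Y @^-1` B) = (P A * gam B)%E.

Lemma sigma_sub_measurable : <<s G >> `<=` measurable.
Proof. by apply: smallest_sub => //; exact: sigma_algebra_measurable. Qed.

Let GT' := g_sigma_algebraType G.
Let idG : T -> GT' := id.
Let midG : measurable_fun setT idG.
Proof. by move=> _ B mB; rewrite setTI; exact: sigma_sub_measurable. Qed.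

HB.instance Definition _ := @isMeasurableFun.Build _ _ T GT' idG midG.
Let PG : probability GT' R := distribution P idG.

Let joint (w : T) : GT' * measurableTypeR R := (idG w, Y w).
Let mjoint : measurable_fun setT joint.
Proof. exact: measurable_fun_pair. Qed.

Lemma sigma_indep A B : <<s G >> A -> measurable B ->
  P (A `&` Y @^-1` B) = (P A * gam B)%E.
Proof.
move=> GA mB.
have mYB : measurable (Y @^-1` B) by rewrite -[X in measurable X]setTI; exact: mY.
pose k : {nonneg R} := NngNum (fine_ge0 (measure_ge0 gam B)).
have kE : k%:num%:E = gam B by rewrite /k/= fineK ?fin_num_measure.
rewrite muleC -kE -[LHS]/(mrestr P mYB A) -[RHS]/(mscale k P A).
apply: (g_sigma_algebra_measure_unique G mG (fun=> setT)) => //.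
- by apply/seteqP; split => // x _; exists 0%N.
- move=> C GC; rewrite -[RHS]/(k%:num%:E * P C)%E kE muleC -indep//.
- move=> _; apply: (@le_lt_trans _ _ 1%E); last exact: ltry.
  by apply: probability_le1; exact: measurableI.
Qed.

Local Open Scope ereal_scope.
(** Independence says that the law of w |-> (w, Y w), with the first copy of the
sample space carrying only the sigma-algebra generated by G, is a product
measure.  Tonelli then lets Y be integrated out while the past is kept fixed;
this replaces conditioning on the past. *)
Lemma integral_freeze (f : GT' * measurableTypeR R -> \bar R) :
  measurable_fun setT f -> (forall z, 0 <= f z) ->
  \int[P]_w f (w, Y w) = \int[P]_w \int[gam]_y f (w, y).
Proof.
move=> mf f0.
transitivity (\int[pushforward P joint]_z f z).
  by rewrite ge0_integral_pushforward.
transitivity (\int[PG \x gam]_z f z).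
  apply: eq_measure_integral => A mA _.
  apply/esym; apply: product_measure_unique => // B C mB mC.
  rewrite /pushforward/= -sigma_indep//.
rewrite fubini_tonelli1// /PG /distribution ge0_integral_pushforward//.
  by apply: measurable_fun_fubini_tonelli_F.
by move=> w _; apply: integral_ge0.
Qed.

End freezing.

(** * Exponentials of Gaussian vectors independent of the past *)

Lemma g_sigma_measurable_funS d' (T : pointedType) (U : measurableType d')
    (G H : set (set T)) (f : T -> U) : G `<=` <<s H >> ->
  measurable_fun setT (f : g_sigma_algebraType G -> U) ->
  measurable_fun setT (f : g_sigma_algebraType H -> U).
Proof.
move=> GH mf _ B mB; rewrite setTI.
have := mf measurableT B mB; rewrite setTI; move: (_ @^-1` _).
by apply: smallest_sub => //; exact: smallest_sigma_algebra.
Qed.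

Section gaussian_step.
Context d (T : measurableType d) (R : realType) (P : probability T R).
Local Open Scope ereal_scope.

Lemma integral_exp_normal_indep (G : set (set T)) (Y : T -> R) (s : R)
    (Z h : T -> R) : s != 0%R ->
  G `<=` measurable -> setI_closed G -> G setT -> measurable_fun setT Y ->
  (forall A B, G A -> measurable B ->
    P (A `&` Y @^-1` B) = P A * normal_prob 0 s B) ->
  measurable_fun setT (Z : g_sigma_algebraType G -> R) ->
  measurable_fun setT (h : g_sigma_algebraType G -> R) ->
  (forall w, 0 <= Z w)%R ->
  \int[P]_w (Z w * expR (h w * Y w - 2^-1 * h w ^+ 2 * s ^+ 2))%:E =
  \int[P]_w (Z w)%:E.
Proof.
move=> s0 mG GI GT mY ind mZ mh Z0.
pose f (z : g_sigma_algebraType G * measurableTypeR R) : \bar R :=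
  (Z z.1 * expR (h z.1 * z.2 - 2^-1 * h z.1 ^+ 2 * s ^+ 2))%:E.
have m1 : measurable_fun setT (fun z : g_sigma_algebraType G * measurableTypeR R => h z.1).
  exact: (measurableT_comp mh).
have mf : measurable_fun setT f.
  apply/measurable_EFinP; apply: measurable_funM.
    exact: (measurableT_comp mZ).
  apply: measurableT_comp => //; apply: measurable_funB.
    by apply: measurable_funM.
  by apply: measurable_funM => //; apply: measurable_funM => //; exact: measurable_funX.
have f0 z : 0 <= f z by rewrite lee_fin mulr_ge0// expR_ge0.
rewrite (integral_freeze (gam := normal_prob 0 s) mG GI GT mY ind mf f0).
apply: eq_integral => w _; rewrite /f/=.
under eq_integral do rewrite EFinM.
rewrite ge0_integralZl//.
- by rewrite integral_normal_exp_martingale// mule1.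
- apply/measurable_EFinP; apply: measurableT_comp => //.
  by apply: measurable_funB => //; apply: measurable_funM.
- by rewrite lee_fin; exact: Z0.
Qed.

(** The coordinates are integrated out one at a time: the past enlarged by the
first k coordinates is still independent of the next one, because the events
that combine a past event with conditions on the first k coordinates form a
pi-system on which the product rule is the hypothesis. *)
Lemma integral_exp_normal_vec n (G : set (set T)) (Y : 'I_n -> T -> R) (s : R)
    (Z : T -> R) (h : 'I_n -> T -> R) : s != 0%R ->
  G `<=` measurable -> setI_closed G -> G setT ->
  (forall i, measurable_fun setT (Y i)) ->
  (forall A (B : 'I_n -> set R), G A -> (forall i, measurable (B i)) ->
    P (A `&` [set w | forall i, B i (Y i w)]) =
    P A * \prod_(i < n) normal_prob 0 s (B i)) ->
  measurable_fun setT (Z : g_sigma_algebraType G -> R) ->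
  (forall i, measurable_fun setT (h i : g_sigma_algebraType G -> R)) ->
  (forall w, 0 <= Z w)%R ->
  \int[P]_w (Z w * expR (\sum_(i < n)
      (h i w * Y i w - 2^-1 * h i w ^+ 2 * s ^+ 2)))%:E =
  \int[P]_w (Z w)%:E.
Proof.
move=> s0 mG GI GT mY ind mZ mh Z0.
pose H k : set (set T) := [set E | exists A (B : 'I_n -> set R),
  [/\ G A, forall i, measurable (B i), (forall i : 'I_n, (k <= i)%N -> B i = setT)
    & E = A `&` [set w | forall i, B i (Y i w)]]].
have GH k : G `<=` <<s H k >>.
  move=> A GA; apply: sub_sigma_algebra; exists A, (fun=> setT); split => //.
  by apply/seteqP; split => [w Aw|w []//]; split.
have mH k : H k `<=` measurable.
  move=> _ [A [B [GA mB _ ->]]]; apply: measurableI; first exact: mG.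
  rewrite [X in measurable X](_ : _ = \bigcap_(i in setT) (Y i @^-1` (B i))).
    apply: fin_bigcap_measurable => // i _; rewrite -[X in measurable X]setTI.
    exact: mY.
  by apply/seteqP; split => [w + i _|w + i]; apply.
have HI k : setI_closed (H k).
  move=> _ _ [A [B [GA mB BT ->]]] [A' [B' [GA' mB' BT' ->]]].
  exists (A `&` A'), (fun i => B i `&` B' i); split => //.
  - exact: GI.
  - by move=> i; exact: measurableI.
  - by move=> i ki; rewrite BT// BT'// setTI.
  - apply/seteqP; split => [w [[? b] [? b']]|w [[? ?] b]].
      by split => // i; split.
    by split; split => // i; have [] := b i.
have HT k : H k setT.
  by exists setT, (fun=> setT); split => //; rewrite setTI; apply/seteqP; split.
pose F k w := expR (\sum_(i < n | (i < k)%N)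
      (h i w * Y i w - 2^-1 * h i w ^+ 2 * s ^+ 2)).
suff main k : (k <= n)%N -> \int[P]_w (Z w * F k w)%:E = \int[P]_w (Z w)%:E.
  rewrite -(main n)//; apply: eq_integral => w _; congr (_ * expR _)%:E.
  by apply: eq_bigl => i; rewrite ltn_ord.
elim: k => [_|k IH kn].
  by apply: eq_integral => w _; rewrite /F big_pred0 ?expR0 ?mulr1.
rewrite -IH ?(ltnW kn)//.
have mh' i : measurable_fun setT (h i : g_sigma_algebraType (H k) -> R).
  exact: g_sigma_measurable_funS (GH k) (mh i).
rewrite -[RHS](@integral_exp_normal_indep (H k) (Y (Ordinal kn)) s _ (h (Ordinal kn)))//.
- apply: eq_integral => w _; rewrite -mulrA -expRD.
  congr (_ * expR _)%:E; rewrite (bigD1 (Ordinal kn))//= addrC; congr (_ + _)%R.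
  apply: eq_bigl => i; rewrite ltnS -val_eqE/= andbC.
  by rewrite [RHS]ltn_neqAle.
- move=> A B [A' [B' [GA mB' BT ->]]] mB.
  rewrite ind// [in RHS](bigD1 (Ordinal kn))//= (BT (Ordinal kn))//.
  rewrite probability_setT mul1e -setIA.
  pose B2 (i : 'I_n) := if i == Ordinal kn then B else B' i.
  rewrite (_ : [set w | _] `&` _ = [set w | forall i, B2 i (Y i w)]).
    rewrite ind//; last by move=> i; rewrite /B2; case: ifP.
    rewrite (bigD1 (Ordinal kn))//= {1}/B2 eqxx -muleA; congr (_ * _).
    rewrite muleC; congr (_ * _); apply: eq_bigr => i ik.
    by rewrite /B2 (negbTE ik).
  apply/seteqP; split => [w/= [b bk] i|w/= b].
    by rewrite /B2; case: eqP => [->|].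
  split => [i|].
    have := b i; rewrite /B2; case: eqP => // -> _.
    by rewrite BT.
  by have := b (Ordinal kn); rewrite /B2 eqxx.
- apply: measurable_funM; first exact: g_sigma_measurable_funS (GH k) mZ.
  apply: measurableT_comp => //.
  under eq_fun do rewrite big_mkcond; apply: measurable_sum => i.
  have [ik|ik] := boolP (i < k)%N; last exact: measurable_cst.
  apply: measurable_funB; last first.
    by apply: measurable_funM => //; apply: measurable_funM => //; exact: measurable_funX.
  apply: measurable_funM => //.
  move=> _ B mB; apply: sub_sigma_algebra.
  exists setT, (fun j => if j == i then B else setT); split => //.
  - by move=> j; case: ifP.
  - by move=> j kj; case: eqP => // ji; move: kj; rewrite ji leqNgt ik.
  - apply/seteqP; split => [w/= [_ Bw]|w/= [_ /(_ i)]]; last by rewrite eqxx.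
    by split => // j; case: eqP => [->|].
- by move=> w; rewrite mulr_ge0// expR_ge0.
Qed.

End gaussian_step.

(** * The Brownian filtration *)

Lemma measurable_mx_coord (R : realType) m n (i : 'I_m) (j : 'I_n) :
  measurable_fun setT (fun v : 'M[R]_(m, n) => v i j).
Proof.
apply: (measurability _ (RGenOpens.measurableE R)) => /=.
move=> _ [_ [a [b ->]] <-]; rewrite setTI; apply: sub_sigma_algebra.
by apply: open_comp; [move=> x _; exact: coord_continuous|exact: interval_open].
Qed.

Lemma ae_eq_measure d (T : measurableType d) (R : realType)
    (P : {measure set T -> \bar R}) (A B : set T) :
  measurable A -> measurable B ->
  {ae P, forall w, A w <-> B w} -> P A = P B.
Proof.
move=> mA mB AB.
have PE C : measurable C -> P C = (\int[P]_x (\1_C x)%:E)%E.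
  by move=> mC; rewrite integral_indic// setIT.
rewrite !PE//; apply: ae_eq_integral => //; try by apply/measurable_EFinP.
apply: filterS AB => w AB _; congr EFin.
rewrite !indicE; apply: congr1; congr nat_of_bool.
by apply/idP/idP; rewrite !inE => /AB.
Qed.

Section brownian.
Context {dO : measure_display} {Omega : measurableType dO} {R : realType}
  (P : probability Omega R) {d : nat} (T : R) (W : R -> Omega -> 'cV[R]_d).
Hypothesis BM : brownian_motion P T W.

Lemma natural_filtration_sub t : t <= T ->
  natural_filtration W t `<=` measurable.
Proof.
have [mW _ _ _] := BM.
move=> tT; apply: smallest_sub; first exact: sigma_algebra_measurable.
move=> A [s /=]; rewrite in_itv/= => /andP[s0 st] [B mB <-].
rewrite -[X in measurable X]setTI; apply: mW => //.
by rewrite s0 (le_trans st).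
Qed.

Lemma augmented_filtration_sub t : t <= T ->
  augmented_filtration P W t `<=` measurable.
Proof.
move=> tT; apply: smallest_sub; first exact: sigma_algebra_measurable.
by move=> A [/(natural_filtration_sub tT)|[]].
Qed.

Lemma natural_filtrationS s t : s <= t ->
  natural_filtration W s `<=` natural_filtration W t.
Proof.
move=> st; apply: sub_sigma_algebra2 => A [r /=].
rewrite in_itv/= => /andP[r0 rs] [B mB <-].
by exists r => /=; [rewrite in_itv/= r0 (le_trans rs)|exists B].
Qed.

Lemma augmented_filtrationS s t : s <= t ->
  augmented_filtration P W s `<=` augmented_filtration P W t.
Proof.
move=> st; apply: sub_sigma_algebra2 => A [As|As]; [left|by right].
exact: natural_filtrationS As.
Qed.

(** The events with this property form a sigma-algebra containing the natural
filtration and the null sets.  Hence independence of the increments, postulated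
for the natural filtration, passes to the augmented one. *)
Lemma augmented_filtration_ae s A : s <= T -> augmented_filtration P W s A ->
  exists2 A', natural_filtration W s A' & {ae P, forall w, A w <-> A' w}.
Proof.
move=> sT.
pose C : set (set Omega) := [set A | exists2 A', natural_filtration W s A' &
  {ae P, forall w, A w <-> A' w}].
suff: augmented_filtration P W s `<=` C by apply.
have [n0 nD nU] := smallest_sigma_algebra setT
  (\bigcup_(r in `[0, s]) [set W r @^-1` B | B in measurable]).
apply: smallest_sub; last first.
  move=> B [nB|[mB B0]].
    by exists B => //; exact: aeW.
  exists set0; first exact: n0.
  have : {ae P, forall w, ~ B w}.
    by exists B; split => // w /= /contrapT.
  by apply: filterS => w.
split.
- by exists set0; [exact: n0|exact: aeW].
- move=> B [B' nB BB']; exists (setT `\` B'); first exact: nD.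
  by apply: filterS BB' => w BB'; rewrite !setTD /=; split=> + /BB'.
- move=> B BC.
  have /choice[B' BB'] : forall i, exists B', natural_filtration W s B' /\
      {ae P, forall w, B i w <-> B' w}.
    by move=> i; have [B'] := BC i; exists B'.
  exists (\bigcup_i B' i); first by apply: nU => i; have [] := BB' i.
  have : {ae P, forall w i, B i w <-> B' i w}.
    by apply: ae_foralln => i; have [] := BB' i.
  by apply: filterS => w H; split => -[i _ /H]; exists i.
Qed.

Lemma brownian_increment_indep s t (A : set Omega) (B : 'I_d -> set R) :
  0 <= s -> s < t -> t <= T ->
  augmented_filtration P W s A -> (forall i, measurable (B i)) ->
  (P (A `&` [set w | forall i, B i (W t w i 0%R - W s w i 0%R)%R]) =
   P A * \prod_(i < d) normal_prob 0 (Num.sqrt (t - s)) (B i))%E.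
Proof.
move=> s0 st tT aA mB; have [mW _ _ ind] := BM.
have sT : s <= T by rewrite (le_trans (ltW st)).
have [A' nA' AA'] := augmented_filtration_ae sT aA.
have mA := augmented_filtration_sub sT aA.
have mA' := natural_filtration_sub sT nA'.
have mE : measurable [set w | forall i, B i (W t w i 0%R - W s w i 0%R)%R].
  rewrite [X in measurable X](_ : _ = \bigcap_(i in setT)
      ((fun w => W t w i 0%R - W s w i 0%R)%R @^-1` (B i))).
    apply: fin_bigcap_measurable => // i _; rewrite -[X in measurable X]setTI.
    have t0 := le_trans s0 (ltW st).
    apply: measurable_funB => //.
    - by apply: (measurableT_comp (measurable_mx_coord _ _)); apply: mW; rewrite t0.
    - by apply: (measurableT_comp (measurable_mx_coord _ _)); apply: mW; rewrite s0.
  by apply/seteqP; split => [w + i _|w + i]; apply.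
rewrite (ae_eq_measure mA mA' AA') -ind//.
apply: ae_eq_measure; [exact: measurableI..|].
by apply: filterS AA' => w AA'; split => -[/AA'].
Qed.

End brownian.

(** * Grids of times *)

Section grid.
Context {R : realType}.
Variables (r : nat -> R) (m : nat).
Hypothesis rS : forall k, (k < m)%N -> r k <= r k.+1.

Definition on_grid (x : R) : Prop :=
  r 0%N <= x <= r m /\ forall k, (k < m)%N -> x <= r k \/ r k.+1 <= x.

Lemma grid_mono i j : (i <= j <= m)%N -> r i <= r j.
Proof.
elim: j => [|j IH] /andP[ij jm]; first by move: ij; rewrite leqn0 => /eqP ->.
move: ij; rewrite leq_eqVlt => /predU1P[->//|ij].
by rewrite (le_trans (IH _)) ?rS// -ltnS ij ltnW.
Qed.

(** Clamping time to [a, b] cancels the increments outside [a, b] and preserves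
those inside, since no cell of the grid contains a or b in its interior. *)
Lemma grid_telescope (V : zmodType) (w : R -> V) (a b : R) :
  a <= b -> on_grid a -> on_grid b ->
  \sum_(k < m | a < r k.+1 <= b) (w (r k.+1) - w (r k)) = w b - w a.
Proof.
move=> ab [/andP[ra am] Ha] [/andP[rb bm] Hb].
pose g x := w (Num.max a (Num.min x b)).
transitivity (\sum_(0 <= k < m) (g (r k.+1) - g (r k))); last first.
  rewrite telescope_sumr//; congr (w _ - w _).
    by rewrite (min_idPr bm); exact/max_idPr.
  by rewrite (min_idPl rb); exact/max_idPl.
rewrite big_mkord big_mkcond; apply: eq_bigr => k _ /=.
have km := ltn_ord k; have rk := rS km.
rewrite /g; case: ifPn => [/andP[ak kb]|].
  have [ark|] := Ha _ km; last by rewrite leNgt ak.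
  rewrite (min_idPl kb) (min_idPl (le_trans rk kb)).
  by rewrite (max_idPr ark) (max_idPr (le_trans ark rk)).
rewrite negb_and -leNgt -ltNge => /orP[ka|bk].
  have ka' := le_trans rk ka.
  rewrite (min_idPl (le_trans ka ab)) (min_idPl (le_trans ka' ab)).
  by rewrite (max_idPl ka) (max_idPl ka') subrr.
have [brk|] := Hb _ km; last by rewrite leNgt bk.
by rewrite (min_idPr brk) (min_idPr (le_trans brk rk)) subrr.
Qed.

(** No point of the grid separates s from the right endpoint of its cell. *)
Lemma on_grid_step x s k : on_grid x -> (k < m)%N -> r k < s <= r k.+1 ->
  ((x < s) = (x < r k.+1)) * ((s <= x) = (r k.+1 <= x)).
Proof.
move=> [_ H] km /andP[ks sk]; have [xk|kx] := H _ km.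
- have xs := le_lt_trans xk ks.
  by rewrite xs (lt_le_trans xs sk) !leNgt xs (lt_le_trans xs sk).
- by rewrite kx (le_trans sk kx) !ltNge kx (le_trans sk kx).
Qed.

Lemma integral_grid_step (f : R -> R) : (forall s, 0 <= f s) ->
  (forall k s, (k < m)%N -> r k < s <= r k.+1 -> f s = f (r k.+1)) ->
  (\int[lebesgue_measure]_(s in `[r 0%N, r m]) (f s)%:E =
   (\sum_(k < m) f (r k.+1) * (r k.+1 - r k))%:E)%E.
Proof.
move=> f0 fr.
suff main k : (k <= m)%N -> measurable_fun (`]r 0%N, r k] : set R) f /\
    (\int[lebesgue_measure]_(s in `]r 0%N, r k]) (f s)%:E =
     (\sum_(k < k) f (r k.+1) * (r k.+1 - r k))%:E)%E.
  have [mf <-] := main m (leqnn m).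
  rewrite integral_itv_obnd_cbnd//; exact/measurable_EFinP.
elim: k => [_|k IH km].
  rewrite big_ord0 set_itvoc0 integral_set0; split => //.
  exact: measurable_fun_set0.
have [mf If] := IH (ltnW km).
have r0k : r 0%N <= r k by rewrite grid_mono//= ltnW.
have mk : measurable_fun (`]r k, r k.+1] : set R) f.
  apply: (eq_measurable_fun (cst (f (r k.+1)))) => // s.
  by rewrite inE/= in_itv/= => sk; rewrite (fr k).
have U : `]r 0%N, r k.+1]%classic = `]r 0%N, r k] `|` `]r k, r k.+1].
  by apply: itv_bndbnd_setU; rewrite bnd_simp// rS.
rewrite U; split; first exact/measurable_funU.
rewrite ge0_integral_setU//=.
- rewrite If big_ord_recr/= EFinD; congr (_ + _)%E.
  rewrite (eq_integral (cst (f (r k.+1))%:E)); last first.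
    by move=> s; rewrite inE/= in_itv/= => sk; rewrite (fr k).
  rewrite integral_cst//= lebesgue_measure_itv/= lte_fin.
  case: ltP => [_|rk]; first by rewrite -EFinD -EFinM.
  have -> : r k.+1 = r k by apply/eqP; rewrite eq_le rk rS.
  by rewrite subrr mulr0 mule0.
- by apply/measurable_EFinP/measurable_funU.
- by move=> s _; rewrite lee_fin.
- rewrite disj_set2E; apply/eqP/seteqP; split => s //=.
  by rewrite !in_itv/= => -[/andP[_ sk] /andP[ks _]]; move: ks; rewrite ltNge sk.
Qed.

End grid.

(** * Exponential martingales along a grid *)

Lemma measurable_wrt_coord dO (Omega : measurableType dO) (R : realType) d
    (G : set (set Omega)) (H : Omega -> 'rV[R]_d) (i : 'I_d) :
  measurable_wrt G H ->
  measurable_fun setT ((fun w => H w 0 i) : g_sigma_algebraType G -> R).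
Proof.
move=> mH _ B mB; apply: sub_sigma_algebra; rewrite setTI.
rewrite (_ : _ @^-1` _ = H @^-1` ((fun v : 'rV[R]_d => v 0 i) @^-1` B)) //.
by apply: mH; rewrite -[X in measurable X]setTI; exact: measurable_mx_coord.
Qed.

Section brownian_exponential.
Context {dO : measure_display} {Omega : measurableType dO} {R : realType}
  (P : probability Omega R) {d : nat} (T : R) (W : R -> Omega -> 'cV[R]_d).
Hypothesis BM : brownian_motion P T W.

Let F t := augmented_filtration P W t.

Let FI t : setI_closed (F t).
Proof.
have := @measurableI _ (g_sigma_algebraType
  (natural_filtration W t `|` [set N | measurable N /\ P N = 0%E])).
exact.
Qed.

Let FT t : F t setT.
Proof.
exact: (@measurableT _ (g_sigma_algebraType
  (natural_filtration W t `|` [set N | measurable N /\ P N = 0%E]))).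
Qed.

Lemma measurable_brownian_coord t s i : 0 <= t <= s ->
  measurable_fun setT ((fun w => W t w i 0) : g_sigma_algebraType (F s) -> R).
Proof.
move=> /andP[t0 ts] _ B mB; rewrite setTI; apply: sub_sigma_algebra.
apply: sub_sigma_algebra; left; apply: sub_sigma_algebra.
exists t => /=; first by rewrite in_itv/= t0.
exists ((fun v : 'cV[R]_d => v i 0) @^-1` B) => //.
by rewrite -[X in measurable X]setTI; exact: measurable_mx_coord.
Qed.

Definition grid_exponent (r : nat -> R) (h : nat -> Omega -> 'rV[R]_d) m w : R :=
  \sum_(k < m) ((h k w *m (W (r k.+1) w - W (r k) w)) 0 0
     - 2^-1 * sqnorm (h k w)^T * (r k.+1 - r k)).

Lemma integral_grid_exponent (r : nat -> R) (h : nat -> Omega -> 'rV[R]_d) m :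
  0 <= r 0%N -> r m <= T ->
  (forall k, (k < m)%N -> r k <= r k.+1) ->
  (forall k i, (k < m)%N -> measurable_fun setT
     ((fun w => h k w 0 i) : g_sigma_algebraType (F (r k)) -> R)) ->
  (\int[P]_w (expR (grid_exponent r h m w))%:E = 1)%E.
Proof.
move=> r0 rT rS hF.
have rmono i j : (i <= j <= m)%N -> r i <= r j by exact: grid_mono.
(* The exponential up to time r k has to be known at time r k for the next
   increment to be independent of it. *)
suff main k : (k <= m)%N ->
    measurable_fun setT ((expR \o grid_exponent r h k) : g_sigma_algebraType (F (r k)) -> R) /\
    (\int[P]_w (expR (grid_exponent r h k w))%:E = 1)%E.
  by have [] := main m (leqnn m).
elim: k => [_|k IH km].
  have e w : grid_exponent r h 0 w = 0 by rewrite /grid_exponent big_ord0.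
  split.
    rewrite [X in measurable_fun _ X](_ : _ = cst 1) //.
    by apply/funext => w /=; rewrite e expR0.
  under eq_integral do rewrite e expR0.
  by rewrite integral_cst//= mul1e probability_setT.
have [mk Ik] := IH (ltnW km).
have rk0 : 0 <= r k by rewrite (le_trans r0)// rmono//= ltnW.
have rk : r k <= r k.+1 by exact: rS.
have rk1T : r k.+1 <= T by rewrite (le_trans _ rT)// rmono// km leqnn.
have sub : F (r k) `<=` <<s F (r k.+1) >>.
  move=> A FA; apply: sub_sigma_algebra; exact: augmented_filtrationS FA.
have mh i := hF k i km.
have gE w : grid_exponent r h k.+1 w = grid_exponent r h k w +
    \sum_(i < d) (h k w 0 i * (W (r k.+1) w i 0 - W (r k) w i 0)
                  - 2^-1 * h k w 0 i ^+ 2 * (r k.+1 - r k)).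
  rewrite /grid_exponent big_ord_recr/=; congr +%R.
  rewrite mxE /sqnorm sumrB; congr (_ - _).
    by apply: eq_bigr => i _; rewrite !mxE.
  by rewrite mulr_sumr mulr_suml; apply: eq_bigr => i _; rewrite mxE.
split.
  apply: measurableT_comp => //.
  rewrite (funext gE).
  apply: measurable_funD.
    have -> : grid_exponent r h k = @ln R \o (expR \o grid_exponent r h k).
      by apply/funext => w /=; rewrite expRK.
    by apply: measurableT_comp => //; exact: g_sigma_measurable_funS mk.
  apply: measurable_sum => i.
  have mh' := g_sigma_measurable_funS sub (mh i).
  apply: measurable_funB.
    apply: measurable_funM => //; apply: measurable_funB.
      by apply: measurable_brownian_coord; rewrite (le_trans rk0) ?lexx.
    by apply: measurable_brownian_coord; rewrite rk0.
  by apply: measurable_funM => //; apply: measurable_funM => //; exact: measurable_funX.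
rewrite -Ik; move: rk; rewrite le_eqVlt => /predU1P[rE|rk].
  apply: eq_integral => w _; rewrite gE big1 ?addr0// => i _.
  by rewrite -rE !subrr !mulr0 subrr.
have [mW _ _ _] := BM.
rewrite -[RHS](@integral_exp_normal_vec _ _ _ P d (F (r k))
  (fun i w => W (r k.+1) w i 0 - W (r k) w i 0) (Num.sqrt (r k.+1 - r k)) _
  (fun i w => h k w 0 i)) //.
- apply: eq_integral => w _; rewrite gE expRD; congr (_ * expR _)%:E.
  by apply: eq_bigr => i _; rewrite sqr_sqrtr// subr_ge0 ltW.
- by rewrite gt_eqF// sqrtr_gt0 subr_gt0.
- by apply: (augmented_filtration_sub BM); rewrite (le_trans (ltW rk)).
- move=> i; apply: measurable_funB.
  + by apply: (measurableT_comp (measurable_mx_coord _ _)); apply: mW;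
      rewrite rk1T (le_trans rk0 (ltW rk)).
  + by apply: (measurableT_comp (measurable_mx_coord _ _)); apply: mW;
      rewrite rk0 (le_trans (ltW rk)).
- by move=> A B FA mB; apply: (brownian_increment_indep BM).
Qed.

End brownian_exponential.

(** * Simple processes on a common grid *)

Lemma grid_of_seq (R : realType) (T : R) (l : seq R) : 0 <= T ->
  {in l, forall x, 0 <= x <= T} ->
  exists r m, [/\ r 0%N = 0, r m = T,
    forall k, (k < m)%N -> r k <= r k.+1 & {in l, forall x, on_grid r m x}].
Proof.
move=> T0 lT; pose s := sort <=%R [:: 0, T & l].
have sz : size s = (size l).+2 by rewrite size_sort.
have ms x : (x \in s) = (x \in [:: 0, T & l]) by rewrite mem_sort.
have sT x : x \in s -> 0 <= x <= T.
  by rewrite ms !inE => /or3P[/eqP->|/eqP->|/lT//]; rewrite lexx T0.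
pose r k := nth T s k; pose m := (size l).+1.
have rm i j : (i <= j)%N -> (j <= m)%N -> r i <= r j.
  move=> ij jm; apply: (sorted_leq_nth le_trans) => //.
  - exact/sort_le_sorted.
  - by rewrite inE sz ltnS (leq_trans ij).
  - by rewrite inE sz ltnS.
have rs k : (k <= m)%N -> r k \in s by move=> km; rewrite mem_nth// sz ltnS.
have rx x : x \in s -> exists2 i, (i <= m)%N & r i = x.
  move=> xs; exists (index x s); last exact: nth_index.
  by rewrite -ltnS -/m -sz index_mem.
have r0 : r 0%N = 0.
  have [i im ri] := rx 0 (ltac:(by rewrite ms !inE eqxx)).
  apply/eqP; rewrite eq_le -{1}ri rm//=.
  by have /andP[] := sT _ (rs 0%N isT).
have rT : r m = T.
  have [i im ri] := rx T (ltac:(by rewrite ms !inE eqxx orbT)).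
  apply/eqP; rewrite eq_le -{2}ri rm// andbT.
  by have /andP[] := sT _ (rs m (leqnn m)).
exists r, m; split => //; first by move=> k km; exact: rm.
move=> x xl; have xs : x \in s by rewrite ms !inE xl !orbT.
split; first by rewrite r0 rT; exact: sT.
move=> k km; have [i im <-] := rx _ xs.
by have [ik|ki] := leqP i k; [left; apply: rm => //; exact: ltnW|right; exact: rm].
Qed.

Section simple_process_grid.
Context {dO : measure_display} {Omega : measurableType dO} {R : realType}
  {d : nat}.
Variables (S : @simple_process _ Omega R d) (r : nat -> R) (m : nat).
Hypothesis rS : forall k, (k < m)%N -> r k <= r k.+1.
Hypothesis Sr : forall j, (j <= sp_size S)%N -> on_grid r m (sp_time S j).

Lemma sp_val_grid k s w : (k < m)%N -> r k < s <= r k.+1 ->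
  sp_val S s w = sp_val S (r k.+1) w.
Proof.
move=> km ks; apply: eq_bigl => j.
rewrite !(on_grid_step (Sr _) km ks)//; first exact: ltnW.
Qed.

Lemma sp_int_grid (W : R -> Omega -> 'cV[R]_d) w :
  (forall j, (j < sp_size S)%N -> sp_time S j <= sp_time S j.+1) ->
  sp_int W S w =
  \sum_(k < m) (sp_val S (r k.+1) w *m (W (r k.+1) w - W (r k) w)) 0 0.
Proof.
move=> St; transitivity (\sum_(j < sp_size S) \sum_(k < m | sp_time S j < r k.+1 <= sp_time S j.+1)
    (sp_coef S j w *m (W (r k.+1) w - W (r k) w)) 0 0).
  apply: eq_bigr => j _; have jS := ltn_ord j.
  rewrite -(grid_telescope rS (fun s => W s w) (St _ jS) (Sr (ltnW jS)) (Sr jS)).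
  by rewrite mulmx_sumr summxE.
under eq_bigr do rewrite big_mkcond.
rewrite exchange_big/=; apply: eq_bigr => k _.
rewrite /sp_val mulmx_suml summxE [RHS]big_mkcond/=.
by apply: eq_bigr.
Qed.

Lemma measurable_sp_val_grid (F : R -> set (set Omega)) k i : (k < m)%N ->
  (forall s t, s <= t -> F s `<=` F t) ->
  (forall j, (j < sp_size S)%N -> measurable_wrt (F (sp_time S j)) (sp_coef S j)) ->
  measurable_fun setT
    ((fun w => sp_val S (r k.+1) w 0 i) : g_sigma_algebraType (F (r k)) -> R).
Proof.
move=> km FS mS; rewrite (_ : (fun w => _) = (fun w => \sum_(j < sp_size S)
    if (sp_time S j < r k.+1 <= sp_time S j.+1) then sp_coef S j w 0 i else 0)).
  apply: measurable_sum => j.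
  have [/andP[jk _]|_] := boolP (sp_time S j < r k.+1 <= sp_time S j.+1); last first.
    exact: measurable_cst.
  have [_ /(_ _ km)[jrk|]] := Sr (ltnW (ltn_ord j)); last by rewrite leNgt jk.
  apply: (g_sigma_measurable_funS _ (measurable_wrt_coord i (mS j (ltn_ord j)))).
  by move=> A FA; apply: sub_sigma_algebra; exact: FS FA.
by apply/funext => w; rewrite /sp_val summxE big_mkcond.
Qed.

End simple_process_grid.

Lemma common_grid {dO : measure_display} {Omega : measurableType dO}
    {R : realType} {d : nat} (T : R) (F : R -> set (set Omega))
    (S1 S2 : @simple_process _ Omega R d) :
  0 <= T -> is_simple F T S1 -> is_simple F T S2 ->
  exists r m, [/\ r 0%N = 0, r m = T,
    forall k, (k < m)%N -> r k <= r k.+1,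
    forall j, (j <= sp_size S1)%N -> on_grid r m (sp_time S1 j) &
    forall j, (j <= sp_size S2)%N -> on_grid r m (sp_time S2 j)].
Proof.
move=> T0 [S10 S1S S1T S1m _] [S20 S2S S2T S2m _].
have tm (S : @simple_process _ Omega R d) : 0 <= sp_time S 0%N ->
    (forall k, (k < sp_size S)%N -> sp_time S k <= sp_time S k.+1) ->
    sp_time S (sp_size S) <= T ->
    forall j, (j <= sp_size S)%N -> 0 <= sp_time S j <= T.
  move=> S0 SS ST j jS; rewrite (le_trans S0)/=; last by rewrite (grid_mono SS).
  by rewrite (le_trans _ ST)// (grid_mono SS)// jS leqnn.
pose l := [seq sp_time S1 j | j <- iota 0 (sp_size S1).+1] ++
          [seq sp_time S2 j | j <- iota 0 (sp_size S2).+1].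
have [] := @grid_of_seq R T l T0.
  move=> x; rewrite mem_cat => /orP[] /mapP[j]; rewrite mem_iota/= add0n ltnS => jS ->.
    exact: (tm _ S10 S1S S1T).
  exact: (tm _ S20 S2S S2T).
move=> r [m [r0 rT rS rl]]; exists r, m; split => // j jS; apply: rl.
  rewrite mem_cat; apply/orP; left.
  by apply: map_f; rewrite mem_iota.
rewrite mem_cat; apply/orP; right.
by apply: map_f; rewrite mem_iota.
Qed.

Section simple_exponential.
Context {dO : measure_display} {Omega : measurableType dO} {R : realType}
  (P : probability Omega R) {d : nat} (T : R) (W : R -> Omega -> 'cV[R]_d).
Hypothesis BM : brownian_motion P T W.

(** The two processes jump at different times; on a grid containing all these
times their linear combination is constant on each cell and known at its left
endpoint. *)
Lemma simple_exponential (S1 S2 : simple_process) (a b : R) : 0 <= T ->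
  is_simple (augmented_filtration P W) T S1 ->
  is_simple (augmented_filtration P W) T S2 ->
  (\int[P]_w expeR ((a * sp_int W S1 w + b * sp_int W S2 w)%:E -
    2^-1%:E * \int[lebesgue_measure]_(s in `[0%R, T])
      (sqnorm (a *: sp_val S1 s w + b *: sp_val S2 s w)^T%R)%:E) = 1)%E.
Proof.
move=> T0 S1P S2P; have [r [m [r0 rT rS g1 g2]]] := common_grid T0 S1P S2P.
have [_ S1S _ S1m _] := S1P; have [_ S2S _ S2m _] := S2P.
pose h k w := a *: sp_val S1 (r k.+1) w + b *: sp_val S2 (r k.+1) w.
rewrite -(@integral_grid_exponent _ _ _ P d T W BM r h m) ?r0 ?rT//; last first.
  have FS s t : s <= t -> augmented_filtration P W s `<=` augmented_filtration P W t.
    exact: augmented_filtrationS.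
  move=> k i km; rewrite (_ : (fun w => _) = (fun w => a * sp_val S1 (r k.+1) w 0 i +
      b * sp_val S2 (r k.+1) w 0 i)); last by apply/funext => w; rewrite !mxE.
  apply: measurable_funD; apply: measurable_funM => //.
    exact: (measurable_sp_val_grid g1 i km FS S1m).
  exact: (measurable_sp_val_grid g2 i km FS S2m).
apply: eq_integral => w _.
rewrite -r0 -rT (@integral_grid_step R r m rS (fun s =>
  sqnorm (a *: sp_val S1 s w + b *: sp_val S2 s w)^T)); last 2 first.
- by move=> s; apply: sumr_ge0 => i _; exact: sqr_ge0.
- by move=> k s km ks; rewrite (sp_val_grid g1 w km ks) (sp_val_grid g2 w km ks).
rewrite -EFinM -EFinB /=; congr (EFin (expR _)).
rewrite (sp_int_grid rS g1)// (sp_int_grid rS g2)// !mulr_sumr -big_split/=.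
rewrite -sumrB /grid_exponent; apply: eq_bigr => k _.
rewrite mulrA -/(h k w); congr (_ - _).
by rewrite /h mulmxDl -!scalemxAl [in RHS]mxE; congr (_ + _); rewrite [RHS]mxE.
Qed.

End simple_exponential.

(** * Approximation of Ito integrals *)

Lemma measurable_param_integral d (Omega : measurableType d) (R : realType)
    (D : set R) (g : R * Omega -> \bar R) :
  measurable D -> measurable_fun (D `*` setT) g ->
  (forall z, D z.1 -> 0 <= g z)%E ->
  measurable_fun setT (fun w => (\int[lebesgue_measure]_(s in D) g (s, w))%E).
Proof.
move=> mD mg g0.
have mDT : measurable (D `*` [set: Omega]) by exact: measurableX.
pose f : measurableTypeR R * Omega -> \bar R := g \_ (D `*` setT).
have mf : measurable_fun setT f by exact/(measurable_restrictT _ mDT).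
have f0 z : (0 <= f z)%E.
  by rewrite /f patchE; case: ifPn => // /[!inE] -[Dz _]; exact: g0.
have := measurable_fun_fubini_tonelli_G (m1 := lebesgue_measure) f mf f0.
apply: eq_measurable_fun => w _; rewrite /fubini_G [RHS]integral_mkcond.
apply: eq_integral => s _; rewrite /f !patchE.
by congr (if _ then _ else _); apply/idP/idP; rewrite !inE => // -[].
Qed.

Section subsequence.
Context d (Omega : measurableType d) (R : realType) (P : probability Omega R).
Variables (Y Z : nat -> Omega -> \bar R).
Hypotheses (mY : forall n, measurable_fun setT (Y n))
           (mZ : forall n, measurable_fun setT (Z n)).
Hypotheses (Y0 : cvg0_in_probability P Y) (Z0 : cvg0_in_probability P Z).

Let small (U : nat -> Omega -> \bar R) k (e : R) : 0 < e ->
  cvg0_in_probability P U -> (forall n, measurable_fun setT (U n)) ->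
  \forall n \near \oo, (P [set w | ((4^-1 ^+ k)%:E <= U n w)%E] <= e%:E)%E.
Proof.
move=> e0 U0 mU.
have /U0/fine_cvgP[_] : (0 < 4^-1 ^+ k :> R) by rewrite exprn_gt0.
move=> /cvgrPdist_lt/(_ e e0); apply: filterS => n /=.
rewrite sub0r normrN => H.
have mS : measurable [set w | ((4^-1 ^+ k)%:E <= U n w)%E].
  by rewrite -[X in measurable X]setTI; exact: emeasurable_fun_c_infty.
rewrite -[X in (X <= _)%E]fineK ?fin_num_measure// lee_fin.
by rewrite (le_trans (ler_norm _))// ltW.
Qed.

(** Borel-Cantelli along a subsequence on which the exceptional events have
summable probabilities.  The rate 4^-k is what the limit of the exponentials
needs: an error 4^-k in squared distance is affordable against the factor 2^k
that Young's inequality puts in front of it. *)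
Lemma cvg0_in_probability_subseq : exists nk : nat -> nat,
  {ae P, forall w, exists N, forall k, (N <= k)%N ->
     (Y (nk k) w < (4^-1 ^+ k)%:E)%E /\ (Z (nk k) w < (4^-1 ^+ k)%:E)%E}.
Proof.
have e0 k : 0 < 1 / (2 ^ k.+1)%:R :> R by rewrite divr_gt0// ltr0n expn_gt0.
have /choice[nk Hnk] : forall k, exists n,
    (P [set w | ((4^-1 ^+ k)%:E <= Y n w)%E] <= (1 / (2 ^ k.+1)%:R)%:E)%E /\
    (P [set w | ((4^-1 ^+ k)%:E <= Z n w)%E] <= (1 / (2 ^ k.+1)%:R)%:E)%E.
  move=> k; have hY := small k (e0 k) Y0 mY; have hZ := small k (e0 k) Z0 mZ.
  by have [n [? ?]] := filter_ex (filterI hY hZ); exists n.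
exists nk.
pose F k := [set w | ((4^-1 ^+ k)%:E <= Y (nk k) w)%E] `|`
            [set w | ((4^-1 ^+ k)%:E <= Z (nk k) w)%E].
have mF k : measurable (F k).
  by apply: measurableU; rewrite -[X in measurable X]setTI; exact: emeasurable_fun_c_infty.
have PF k : (P (F k) <= (2 / (2 ^ k.+1)%:R)%:E)%E.
  have [h1 h2] := Hnk k.
  apply: (@le_trans _ _ ((1 / (2 ^ k.+1)%:R)%:E + (1 / (2 ^ k.+1)%:R)%:E)%E).
    apply: le_trans (leeD h1 h2).
    by apply: measureU2; rewrite -[X in measurable X]setTI; exact: emeasurable_fun_c_infty.
  by rewrite -EFinD lee_fin -mulrDl.
have F0 : P (lim_sup_set F) = 0%E.
  apply: lim_sup_set_cvg0 => //.
  apply: (@le_lt_trans _ _ 2%:E); last by rewrite ltry.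
  apply: (le_trans _ (@epsilon_trick0 R 2 xpredT _)) => //.
  by apply: lee_nneseries => k *; [exact: measure_ge0|exact: PF].
exists (lim_sup_set F); split => //.
  apply: bigcap_measurable => // n _; exact: bigcup_measurable.
move=> w /= Hw n _; apply: contrapT => nF; apply: Hw; exists n => k nk'.
by split; rewrite ltNge; apply/negP => h; apply: nF; exists k => //; [left|right].
Qed.

End subsequence.

Section simple_measurability.
Context {dO : measure_display} {Omega : measurableType dO} {R : realType}
  (P : probability Omega R) {d : nat} (T : R) (W : R -> Omega -> 'cV[R]_d).
Hypothesis BM : brownian_motion P T W.

Lemma sqnorm_ge0 n (v : 'cV[R]_n) : 0 <= sqnorm v.
Proof. by apply: sumr_ge0 => i _; exact: sqr_ge0. Qed.

Lemma measurable_sqnorm d' (T' : measurableType d') (D : set T') n (H : T' -> 'rV[R]_n) :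
  (forall i, measurable_fun D (fun z => H z 0 i)) ->
  measurable_fun D (fun z => sqnorm (H z)^T).
Proof.
move=> mH; apply: measurable_sum => i; apply: measurable_funX.
by rewrite (_ : (fun _ => _) = (fun z => H z 0 i))//; apply/funext => z; rewrite mxE.
Qed.

Lemma measurable_sub_coord d' (T' : measurableType d') (D : set T') n (i : 'I_n)
    (H K : T' -> 'rV[R]_n) :
  measurable_fun D (fun z => H z 0 i) -> measurable_fun D (fun z => K z 0 i) ->
  measurable_fun D (fun z => (H z - K z) 0 i).
Proof.
move=> mH mK; rewrite (_ : (fun _ => _) = (fun z => H z 0 i - K z 0 i)).
  exact: measurable_funB.
by apply/funext => z; rewrite !mxE.
Qed.

Lemma measurable_comb_coord d' (T' : measurableType d') (D : set T') n (i : 'I_n)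
    (a b : R) (H K : T' -> 'rV[R]_n) :
  measurable_fun D (fun z => H z 0 i) -> measurable_fun D (fun z => K z 0 i) ->
  measurable_fun D (fun z => (a *: H z + b *: K z) 0 i).
Proof.
move=> mH mK; rewrite (_ : (fun _ => _) = (fun z => a * H z 0 i + b * K z 0 i)).
  by apply: measurable_funD; exact: measurable_funM.
by apply/funext => z; rewrite !mxE.
Qed.

Lemma measurable_sp_val (S : @simple_process _ Omega R d) i :
  is_simple (augmented_filtration P W) T S ->
  measurable_fun setT (fun p : R * Omega => sp_val S p.1 p.2 0 i).
Proof.
move=> [_ SS ST mS _].
rewrite (_ : (fun p => _) = (fun p : R * Omega => \sum_(j < sp_size S)
    (\1_(`]sp_time S j, sp_time S j.+1]%classic) p.1 * sp_coef S j p.2 0 i))); last first.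
  apply/funext => -[s w] /=; rewrite /sp_val summxE big_mkcond/=.
  apply: eq_bigr => j _; rewrite indicE mem_setE in_itv/=.
  by case: ifP => _; rewrite ?mul1r ?mul0r.
apply: measurable_sum => j; apply: measurable_funM.
  have m1 : measurable_fun setT (\1_(`]sp_time S j, sp_time S j.+1]%classic) : R -> R).
    exact: measurable_indic.
  exact: (measurableT_comp m1).
apply: (measurableT_comp (f := fun w => sp_coef S j w 0 i)) => //.
have jT : sp_time S j <= T.
  by rewrite (le_trans _ ST)// (grid_mono SS)// leqnn ltnW.
move=> _ B mB; have := measurable_wrt_coord i (mS j (ltn_ord j)) measurableT mB.
apply: smallest_sub; first exact: sigma_algebra_measurable.
exact: (augmented_filtration_sub BM jT).
Qed.

Lemma measurable_sp_int (S : @simple_process _ Omega R d) :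
  is_simple (augmented_filtration P W) T S ->
  measurable_fun setT (sp_int W S).
Proof.
move=> [S0 SS ST mS _].
have mt j : (j <= sp_size S)%N -> 0 <= sp_time S j <= T.
  move=> jS; rewrite (le_trans S0) ?(grid_mono SS)//=.
  by rewrite (le_trans _ ST)// (grid_mono SS)// jS leqnn.
have [mW _ _ _] := BM.
apply: measurable_sum => j; have jS := ltn_ord j.
rewrite (_ : (fun w => _) = (fun w => \sum_(i < d) sp_coef S j w 0 i *
    (W (sp_time S j.+1) w i 0 - W (sp_time S j) w i 0))); last first.
  by apply/funext => w; rewrite mxE; apply: eq_bigr => i _; rewrite !mxE.
apply: measurable_sum => i; apply: measurable_funM.
  have /andP[_ jT] := mt _ (ltnW jS).
  move=> _ B mB; have := measurable_wrt_coord i (mS j jS) measurableT mB.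
  apply: smallest_sub; first exact: sigma_algebra_measurable.
  exact: (augmented_filtration_sub BM jT).
by apply: measurable_funB; apply: (measurableT_comp (measurable_mx_coord _ _));
  apply: mW; apply: mt => //; exact: ltnW.
Qed.

Lemma sp_val_integral_lty (S : @simple_process _ Omega R d) w : 0 <= T ->
  is_simple (augmented_filtration P W) T S ->
  (\int[lebesgue_measure]_(s in `[0%R, T]) (sqnorm (sp_val S s w)^T)%:E < +oo)%E.
Proof.
move=> T0 SP; have [r [m [<- <- rS g _]]] := common_grid T0 SP SP.
rewrite (@integral_grid_step R r m rS (fun s => sqnorm (sp_val S s w)^T)) ?ltry//.
- by move=> s; exact: sqnorm_ge0.
- by move=> k s km ks; rewrite (sp_val_grid g w km ks).
Qed.

End simple_measurability.

Lemma measurable_expeR (R : realType) : measurable_fun setT (@expeR R).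
Proof.
apply: (measurability _ (ErealGenOInfty.measurableE R)) => /=.
move=> _ [_ [r ->] <-]; rewrite setTI.
have [r0|r0] := ltP r 0.
  rewrite [X in measurable X](_ : _ = setT) //; apply/seteqP; split => // x _ /=.
  by rewrite in_itv/= andbT (lt_le_trans _ (expeR_ge0 x))// lte_fin.
have [y ry] : exists y : \bar R, expeR y = r%:E by apply: expeR_total; rewrite lee_fin.
rewrite [X in measurable X](_ : _ = `]y, +oo[%classic); first exact: emeasurable_itv.
by apply/seteqP; split => x /=; rewrite !in_itv/= !andbT -ry lte_expeR.
Qed.

Lemma measurable_section d (T : measurableType d) (R : realType)
    d' (U : measurableType d') (D : set R) (f : R * T -> U) w :
  measurable D -> measurable_fun (D `*` setT) f ->
  measurable_fun D (fun s => f (s, w)).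
Proof.
move=> mD mf _ B mB.
have mDT : measurable (D `*` [set: T]) by exact: measurableX.
have := @pair2_measurable _ _ _ _ w measurableT _ (mf mDT B mB).
rewrite setTI; congr measurable; apply/seteqP; split => [s [[? _] ?]|s [? ?]] //.
Qed.

Lemma le_limn_einf_near (R : realType) (u v : (\bar R)^nat) (l : \bar R) (N : nat) :
  v @ \oo --> l -> (forall k, (N <= k)%N -> (v k <= u k)%E) ->
  (l <= limn_einf u)%E.
Proof.
move=> vl vu; rewrite limn_einf_lim -(cvg_lim _ (cvg_einfs vl))//.
apply: lee_lim; [exact: is_cvg_einfs..|].
exists N => // n Nn /=; apply: le_ereal_inf_tmp => _ [k /= nk <-].
by apply: le_trans (vu _ (leq_trans Nn nk)); apply: ereal_inf_lbound; exists k.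
Qed.

Section linear_combination.
Context d (T : measurableType d) (R : realType) (mu : {measure set T -> \bar R}).
Variables (D : set T) (mD : measurable D).
Local Open Scope ereal_scope.

Lemma le_integral_comb (c1 c2 c3 : R) (f g1 g2 g3 : T -> R) :
  (0 <= c1)%R -> (0 <= c2)%R -> (0 <= c3)%R ->
  measurable_fun D f -> measurable_fun D g1 -> measurable_fun D g2 ->
  measurable_fun D g3 ->
  (forall x, 0 <= f x)%R -> (forall x, 0 <= g1 x)%R -> (forall x, 0 <= g2 x)%R ->
  (forall x, 0 <= g3 x)%R ->
  (forall x, f x <= c1 * g1 x + c2 * g2 x + c3 * g3 x)%R ->
  \int[mu]_(x in D) (f x)%:E <= c1%:E * \int[mu]_(x in D) (g1 x)%:E +
    c2%:E * \int[mu]_(x in D) (g2 x)%:E + c3%:E * \int[mu]_(x in D) (g3 x)%:E.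
Proof.
move=> c10 c20 c30 mf m1 m2 m3 f0 g10 g20 g30 fg.
have mc (c : R) (g : T -> R) : measurable_fun D g -> measurable_fun D (fun x => (c * g x)%:E).
  by move=> mg; apply/measurable_EFinP; exact: measurable_funM.
have c0 (c : R) (g : T -> R) x : (0 <= c)%R -> (forall x, 0 <= g x)%R -> 0 <= (c * g x)%:E.
  by move=> c0 g0; rewrite lee_fin mulr_ge0.
have Z (c : R) (g : T -> R) : (0 <= c)%R -> measurable_fun D g -> (forall x, 0 <= g x)%R ->
    c%:E * \int[mu]_(x in D) (g x)%:E = \int[mu]_(x in D) (c * g x)%:E.
  move=> cp mg g0; under [RHS]eq_integral do rewrite EFinM.
  rewrite ge0_integralZl//; first exact/measurable_EFinP.
  by move=> x _; rewrite lee_fin g0.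
rewrite !Z//.
apply: (@le_trans _ _ (\int[mu]_(x in D)
    ((c1 * g1 x)%:E + (c2 * g2 x)%:E + (c3 * g3 x)%:E))).
  apply: ge0_le_integral => //.
  - by move=> x _; rewrite lee_fin.
  - exact/measurable_EFinP.
  - by apply: emeasurable_funD; [apply: emeasurable_funD|]; exact: mc.
  - by move=> x _; rewrite -!EFinD lee_fin fg.
have m12 : measurable_fun D (fun x => (c1 * g1 x)%:E + (c2 * g2 x)%:E).
  by apply: emeasurable_funD; exact: mc.
rewrite ge0_integralD//; last 3 first.
- by move=> x _; rewrite adde_ge0// c0.
- by move=> x _; rewrite c0.
- exact: mc.
rewrite ge0_integralD//; first by move=> x _; rewrite c0.
- exact: mc.
- by move=> x _; rewrite c0.
- exact: mc.
Qed.
End linear_combination.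

Section sqnorm_ineq.
Context (R : realType) (n : nat).
Implicit Types x y : 'rV[R]_n.

Lemma sqnorm_approx x y :
  sqnorm x^T <= 2 * sqnorm (y - x)^T + 2 * sqnorm y^T.
Proof.
rewrite /sqnorm !mulr_sumr -big_split/=; apply: ler_sum => i _.
by rewrite !mxE; set a := x _ _; set b := y _ _; have := sqr_ge0 (b - a + b); nra.
Qed.

(** Young's inequality: the parameter e is sent to 0 together with the
distances, so that the energy of the limit is not overestimated. *)
Lemma sqnorm_comb_approx (a b e : R) x1 x2 y1 y2 : 0 < e ->
  sqnorm (a *: y1 + b *: y2)^T <= (1 + e) * sqnorm (a *: x1 + b *: x2)^T +
    ((1 + e^-1) * (2 * a ^+ 2)) * sqnorm (y1 - x1)^T +
    ((1 + e^-1) * (2 * b ^+ 2)) * sqnorm (y2 - x2)^T.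
Proof.
move=> e0; rewrite /sqnorm !mulr_sumr -!big_split/=; apply: ler_sum => i _.
rewrite !mxE; set p1 := x1 _ _; set p2 := x2 _ _; set q1 := y1 _ _; set q2 := y2 _ _.
pose A := a * p1 + b * p2; pose B := a * (q1 - p1); pose C := b * (q2 - p2).
have -> : a * q1 + b * q2 = A + (B + C) by rewrite /A /B /C; ring.
have young : (A + (B + C)) ^+ 2 <= (1 + e) * A ^+ 2 + (1 + e^-1) * (B + C) ^+ 2.
  rewrite -subr_ge0.
  have -> : (1 + e) * A ^+ 2 + (1 + e^-1) * (B + C) ^+ 2 - (A + (B + C)) ^+ 2 =
      e^-1 * (e * A - (B + C)) ^+ 2 by field; rewrite gt_eqF.
  by rewrite mulr_ge0 ?sqr_ge0// invr_ge0 ltW.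
apply: (le_trans young); rewrite -addrA lerD2l -/B -/C.
rewrite -!mulrA -mulrDr ler_pM2l; last by rewrite addr_gt0// invr_gt0.
by have := sqr_ge0 (B - C); rewrite /B /C; nra.
Qed.

End sqnorm_ineq.

Section ito_approximation.
Context {dO : measure_display} {Omega : measurableType dO} {R : realType}
  (P : probability Omega R) {d : nat} (T : R) (W : R -> Omega -> 'cV[R]_d).
Hypothesis BM : brownian_motion P T W.
Hypothesis T0 : 0 <= T.

Lemma measurable_ito_integrand (H : R -> Omega -> 'rV[R]_d) J i :
  ito_integral P W T H J ->
  measurable_fun (`[0, T] `*` setT) (fun p : R * Omega => H p.1 p.2 0 i).
Proof. by move=> [mH _ _ _]; exact: (measurableT_comp (measurable_mx_coord _ _) mH). Qed.

Lemma ito_integral_approx (H : R -> Omega -> 'rV[R]_d) (J : Omega -> R) :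
  ito_integral P W T H J ->
  exists S : nat -> simple_process,
    (forall n, is_simple (augmented_filtration P W) T (S n)) /\
    {ae P, forall w, exists N, forall k, (N <= k)%N ->
      (\int[lebesgue_measure]_(s in `[0%R, T])
         (sqnorm (sp_val (S k) s w - H s w)^T%R)%:E < (4^-1 ^+ k)%:E)%E /\
      (`|sp_int W (S k) w - J w|%:E < (4^-1 ^+ k)%:E)%E}.
Proof.
move=> HJ; have [_ _ mJ [S [SP Y0 Z0]]] := HJ.
pose Y n w := (\int[lebesgue_measure]_(s in `[0%R, T])
         (sqnorm (sp_val (S n) s w - H s w)^T%R)%:E)%E.
pose Z n w := (`|sp_int W (S n) w - J w|%:E)%E.
have mY n : measurable_fun setT (Y n).
  apply: (@measurable_param_integral _ _ _ `[0, T]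
    (fun p => (sqnorm (sp_val (S n) p.1 p.2 - H p.1 p.2)^T%R)%:E)) => //.
    apply/measurable_EFinP; apply: measurable_sqnorm => i.
    apply: measurable_sub_coord; last exact: (measurable_ito_integrand i HJ).
    by apply: measurable_funTS; exact: (measurable_sp_val BM i (SP _)).
  by move=> z _; rewrite lee_fin sqnorm_ge0.
have mZ n : measurable_fun setT (Z n).
  apply/measurable_EFinP; apply: measurableT_comp => //.
  by apply: measurable_funB => //; exact: (measurable_sp_int BM (SP n)).
have [nk Hnk] := cvg0_in_probability_subseq mY mZ Y0 Z0.
by exists (S \o nk); split => [n|]; [exact: SP|exact: Hnk].
Qed.

(** A simple process has finite energy along every path and is eventually at
finite distance from the integrand. *)
Lemma ito_integrand_sq_lty (H : R -> Omega -> 'rV[R]_d) (J : Omega -> R) :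
  ito_integral P W T H J ->
  {ae P, forall w, (\int[lebesgue_measure]_(s in `[0%R, T])
     (sqnorm (H s w)^T)%:E < +oo)%E}.
Proof.
move=> HJ; have [S [SP]] := ito_integral_approx HJ.
apply: filterS => w [N /(_ N (leqnn N))[DN _]].
have mH i : measurable_fun (`[0, T] : set (measurableTypeR R)) (fun s => H s w 0 i).
  exact: (measurable_section w _ (measurable_ito_integrand i HJ)).
have mS i : measurable_fun (`[0, T] : set (measurableTypeR R)) (fun s => sp_val (S N) s w 0 i).
  apply: (measurable_section (f := fun p => sp_val (S N) p.1 p.2 0 i) w) => //.
  by apply: measurable_funTS; exact: (measurable_sp_val BM i (SP _)).
apply: le_lt_trans.
  (* Two terms suffice here: the third one is 0. *)
  apply: (@le_integral_comb _ _ _ lebesgue_measure `[0, T] _ 2 2 0 _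
    (fun s => sqnorm (sp_val (S N) s w - H s w)^T)
    (fun s => sqnorm (sp_val (S N) s w)^T) (fun=> 0)) => //.
  - exact: measurable_sqnorm.
  - by apply: measurable_sqnorm => i; apply: measurable_sub_coord.
  - exact: measurable_sqnorm.
  - by move=> s; exact: sqnorm_ge0.
  - by move=> s; exact: sqnorm_ge0.
  - by move=> s; exact: sqnorm_ge0.
  - by move=> s; rewrite mul0r addr0; exact: sqnorm_approx.
rewrite mul0e adde0; apply: lte_add_pinfty.
  by apply: lte_mul_pinfty => //; exact: lt_trans DN (ltry _).
apply: lte_mul_pinfty => //.
exact: (sp_val_integral_lty w T0 (SP N)).
Qed.

End ito_approximation.

(** * Stochastic exponentials have expectation at most 1 *)

Section ito_exponential.
Context {dO : measure_display} {Omega : measurableType dO} {R : realType}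
  (P : probability Omega R) {d : nat} (T : R) (W : R -> Omega -> 'cV[R]_d).
Hypothesis BM : brownian_motion P T W.
Hypothesis T0 : 0 <= T.

Let ener (H1 H2 : R -> Omega -> 'rV[R]_d) (a b : R) w : \bar R :=
  (\int[lebesgue_measure]_(s in `[0%R, T])
    (sqnorm (a *: H1 s w + b *: H2 s w)^T%R)%:E)%E.

Let measurable_ener (H1 H2 : R -> Omega -> 'rV[R]_d) (a b : R) :
  (forall i, measurable_fun (`[0, T] `*` setT) (fun p : R * Omega => H1 p.1 p.2 0 i)) ->
  (forall i, measurable_fun (`[0, T] `*` setT) (fun p : R * Omega => H2 p.1 p.2 0 i)) ->
  measurable_fun setT (ener H1 H2 a b).
Proof.
move=> m1 m2.
apply: (@measurable_param_integral _ _ _ `[0, T]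
    (fun p => (sqnorm (a *: H1 p.1 p.2 + b *: H2 p.1 p.2)^T%R)%:E)) => //.
  apply/measurable_EFinP; apply: measurable_sqnorm => i.
  exact: measurable_comb_coord.
by move=> z _; rewrite lee_fin sqnorm_ge0.
Qed.

Let measurable_exponential (x : Omega -> R) (E : Omega -> \bar R) :
  measurable_fun setT x -> measurable_fun setT E ->
  measurable_fun setT (fun w => expeR ((x w)%:E - 2^-1%:E * E w)%E).
Proof.
move=> mx mE; apply: (measurableT_comp (@measurable_expeR R)).
by apply: emeasurable_funB; [exact/measurable_EFinP|exact: measurable_funeM].
Qed.

(** The deterministic part of the passage to the limit.  Only a lower bound of the
inferior limit is needed, so it is enough to bound the energies N k from above.
With e = 2^-k in the Young-type hypothesis the error is of order 2^-k. *)
Let pathwise (a b x1 x2 : R) (I1 I2 : nat -> R) (E : \bar R) (D1 D2 N : nat -> \bar R) (n : nat) :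
  (0 <= E)%E ->
  (forall k, (n <= k)%N -> [/\ (D1 k < (4^-1 ^+ k)%:E)%E, (D2 k < (4^-1 ^+ k)%:E)%E,
     `|I1 k - x1| < 4^-1 ^+ k & `|I2 k - x2| < 4^-1 ^+ k]) ->
  (forall k e, 0 < e -> (N k <= (1 + e)%:E * E +
    ((1 + e^-1) * (2 * a ^+ 2))%:E * D1 k + ((1 + e^-1) * (2 * b ^+ 2))%:E * D2 k)%E) ->
  (expeR ((a * x1 + b * x2)%:E - 2^-1%:E * E) <=
   limn_einf (fun k => expeR ((a * I1 k + b * I2 k)%:E - 2^-1%:E * N k)))%E.
Proof.
case: E => [e| |//]; last first.
  move=> _ _ _; rewrite mulry gtr0_sg ?invr_gt0// mul1e /=.
  apply: (@le_limn_einf_near _ _ (cst 0%E) _ 0%N); first exact: cvg_cst.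
  by move=> k _; exact: expeR_ge0.
rewrite lee_fin => e0 Hn HN.
(* K 2^-k bounds the error made at step k in the exponent. *)
pose K := `|a| + `|b| + 2^-1 * (e + 2 * (2 * a ^+ 2 + 2 * b ^+ 2)).
pose c := a * x1 + b * x2 - 2^-1 * e.
apply: (@le_limn_einf_near _ _ (fun k => (expR (c - 2^-1 ^+ k * K))%:E) _ n).
  apply: cvg_EFin; first by near=> k.
  rewrite (_ : _ \o _ = fun k => expR (c - 2^-1 ^+ k * K)); last by apply/funext.
  rewrite -[X in expR X]subr0 -[X in _ - X](mul0r K).
  apply: continuous_cvg; first exact: continuous_expR.
  apply: cvgB; first exact: cvg_cst.
  apply: cvgMr_tmp; apply: cvg_expr.
  by rewrite ger0_norm ?invr_ge0// invf_lt1 ?ltr1n.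
move=> k nk; have [hD1 hD2 hI1 hI2] := Hn k nk.
have p0 : 0 < 2^-1 ^+ k :> R by rewrite exprn_gt0.
set p := 2^-1 ^+ k in p0 *.
have p1 : p <= 1 by rewrite exprn_ile1// ?invr_ge0// invf_le1// ler1n.
have q : 4^-1 ^+ k = p ^+ 2 :> R.
  by rewrite /p exprAC; congr (_ ^+ k); field.
have hN : (N k <= (e + p * (e + 2 * (2 * a ^+ 2 + 2 * b ^+ 2)))%:E)%E.
  apply: (le_trans (HN k p p0)).
  have cp : 0 <= 1 + p^-1 by rewrite addr_ge0// invr_ge0 ltW.
  apply: (@le_trans _ _ (((1 + p) * e)%:E + ((1 + p^-1) * (2 * a ^+ 2) * p ^+ 2)%:E
     + ((1 + p^-1) * (2 * b ^+ 2) * p ^+ 2)%:E)%E).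
    have L (t : R) D : 0 <= t -> (D < (4^-1 ^+ k)%:E)%E -> (t%:E * D <= (t * p ^+ 2)%:E)%E.
      by move=> t0 hD; rewrite EFinM -q; apply: lee_wpmul2l; [rewrite lee_fin|exact: ltW].
    apply: leeD; last by apply: L => //; do 2 (apply: mulr_ge0 => //); exact: sqr_ge0.
    apply: leeD; last by apply: L => //; do 2 (apply: mulr_ge0 => //); exact: sqr_ge0.
    by rewrite EFinM.
  rewrite -!EFinD lee_fin.
  have -> : (1 + p^-1) * (2 * a ^+ 2) * p ^+ 2 = (p + p ^+ 2) * (2 * a ^+ 2).
    by field; rewrite gt_eqF.
  have -> : (1 + p^-1) * (2 * b ^+ 2) * p ^+ 2 = (p + p ^+ 2) * (2 * b ^+ 2).
    by field; rewrite gt_eqF.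
  have pp : p ^+ 2 <= p by rewrite expr2 ger_pMl.
  have := sqr_ge0 a; have := sqr_ge0 b; nra.
rewrite -[leLHS]/(expeR (c - p * K)%:E) lee_expeR.
apply: (@le_trans _ _ ((a * I1 k + b * I2 k)%:E -
    2^-1%:E * (e + p * (e + 2 * (2 * a ^+ 2 + 2 * b ^+ 2)))%:E)%E); last first.
  by apply: leeB => //; apply: lee_wpmul2l => //; rewrite lee_fin invr_ge0.
rewrite -EFinM -EFinB lee_fin.
have h (t y z : R) : `|y - z| < 4^-1 ^+ k -> t * z - p * `|t| <= t * y.
  move=> yz; rewrite lerBlDr -lerBlDl -mulrBr (le_trans (ler_norm _))//.
  rewrite normrM mulrC distrC ler_wpM2r// (le_trans (ltW yz))// q.
  by rewrite expr2 ger_pMl.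
have h1 := h a _ _ hI1; have h2 := h b _ _ hI2.
by rewrite /c /K; lra.
Unshelve. all: by end_near. Qed.

Lemma measurable_ito_exponential (H1 H2 : R -> Omega -> 'rV[R]_d)
    (J1 J2 : Omega -> R) (a b : R) :
  ito_integral P W T H1 J1 -> ito_integral P W T H2 J2 ->
  measurable_fun setT (fun w => expeR ((a * J1 w + b * J2 w)%:E - 2^-1%:E *
    \int[lebesgue_measure]_(s in `[0%R, T])
      (sqnorm (a *: H1 s w + b *: H2 s w)^T%R)%:E)%E).
Proof.
move=> HJ1 HJ2; have [_ _ mJ1 _] := HJ1; have [_ _ mJ2 _] := HJ2.
apply: measurable_exponential.
  by apply: measurable_funD; exact: measurable_funM.
by apply: measurable_ener => i;
  [exact: measurable_ito_integrand HJ1|exact: measurable_ito_integrand HJ2].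
Qed.

Theorem ito_exponential_le1 (H1 H2 : R -> Omega -> 'rV[R]_d)
    (J1 J2 : Omega -> R) (a b : R) :
  ito_integral P W T H1 J1 -> ito_integral P W T H2 J2 ->
  (\int[P]_w expeR ((a * J1 w + b * J2 w)%:E - 2^-1%:E *
    \int[lebesgue_measure]_(s in `[0%R, T])
      (sqnorm (a *: H1 s w + b *: H2 s w)^T%R)%:E) <= 1)%E.
Proof.
move=> HJ1 HJ2; have [_ _ mJ1 _] := HJ1; have [_ _ mJ2 _] := HJ2.
have [S1 [S1P A1]] := ito_integral_approx BM HJ1.
have [S2 [S2P A2]] := ito_integral_approx BM HJ2.
have mH1 i := measurable_ito_integrand i HJ1.
have mH2 i := measurable_ito_integrand i HJ2.
pose U k w := expeR ((a * sp_int W (S1 k) w + b * sp_int W (S2 k) w)%:E -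
    2^-1%:E * ener (fun s w => sp_val (S1 k) s w) (fun s w => sp_val (S2 k) s w) a b w)%E.
have mS (S : nat -> @simple_process _ Omega R d) k (i : 'I_d) :
    is_simple (augmented_filtration P W) T (S k) ->
    measurable_fun (`[0, T] `*` setT) (fun p : R * Omega => sp_val (S k) p.1 p.2 0 i).
  by move=> SP; apply: measurable_funTS; exact: (measurable_sp_val BM i SP).
have mU k : measurable_fun setT (U k).
  apply: measurable_exponential.
    by apply: measurable_funD; apply: measurable_funM => //; exact: (measurable_sp_int BM).
  by apply: measurable_ener => i; exact: mS.
have U0 k w : (0 <= U k w)%E by exact: expeR_ge0.
have U1 k : (\int[P]_w U k w = 1)%E by exact: (simple_exponential BM a b T0).
apply: (@le_trans _ _ (\int[P]_w limn_einf (U ^~ w))%E); last first.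
  apply: (le_trans (fatou P measurableT mU (fun k w _ => U0 k w))).
  by under eq_fun do rewrite U1; rewrite (cvg_limn_einf_sup (cvg_cst 1%E)).1.
apply: ae_ge0_le_integral => //.
- by move=> w _; exact: expeR_ge0.
- apply: measurable_exponential; last exact: measurable_ener.
  by apply: measurable_funD; exact: measurable_funM.
- move=> w _; apply: (@le_limn_einf_near _ _ (cst 0%E) _ 0%N) => //; exact: cvg_cst.
- apply: (measurableT_comp (f := -%E)) => //.
  by apply: measurable_fun_limn_esup => k; exact: measurableT_comp.
apply: filterS2 A1 A2 => w [n1 An1] [n2 An2] _.
have mD (H : R -> Omega -> 'rV[R]_d) i :
    measurable_fun (`[0, T] `*` setT) (fun p : R * Omega => H p.1 p.2 0 i) ->
    measurable_fun (`[0, T] : set (measurableTypeR R)) (fun s => H s w 0 i).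
  by move=> mH; exact: (measurable_section w _ mH).
apply: (pathwise (n := maxn n1 n2) (D1 := fun k => (\int[lebesgue_measure]_(s in `[0%R, T])
         (sqnorm (sp_val (S1 k) s w - H1 s w)^T%R)%:E)%E)
  (D2 := fun k => (\int[lebesgue_measure]_(s in `[0%R, T])
         (sqnorm (sp_val (S2 k) s w - H2 s w)^T%R)%:E)%E)).
- by apply: integral_ge0 => s _; rewrite lee_fin sqnorm_ge0.
- move=> k; rewrite geq_max => /andP[/An1[? ?] /An2[? ?]].
  by split => //; rewrite -lte_fin.
- move=> k e e0; have cp : 0 <= 1 + e^-1 by rewrite addr_ge0// invr_ge0 ltW.
  apply: le_integral_comb => //.
  + by rewrite addr_ge0// ltW.
  + by do 2 (apply: mulr_ge0 => //); exact: sqr_ge0.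
  + by do 2 (apply: mulr_ge0 => //); exact: sqr_ge0.
  + apply: measurable_sqnorm => i; apply: measurable_comb_coord; apply: mD; exact: mS.
  + apply: measurable_sqnorm => i; apply: measurable_comb_coord; exact: mD.
  + apply: measurable_sqnorm => i; apply: measurable_sub_coord; apply: mD => //; exact: mS.
  + apply: measurable_sqnorm => i; apply: measurable_sub_coord; apply: mD => //; exact: mS.
  + by move=> s; exact: sqnorm_ge0.
  + by move=> s; exact: sqnorm_ge0.
  + by move=> s; exact: sqnorm_ge0.
  + by move=> s; exact: sqnorm_ge0.
  + by move=> s; exact: sqnorm_comb_approx.
Qed.

End ito_exponential.

(** * Measurability on path space *)

Section cpath_measurable.
Context {R : realType} {d : nat} (T : R) (x0 : 'cV[R]_d).
Hypothesis T0 : 0 <= T.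
Let C := cpath T x0.

(** Evaluation at a time in [0, T] is continuous for uniform convergence, and a path
is constant on either side of [0, T]. *)
Lemma measurable_cpath_eval t (O : set 'cV[R]_d) : open O ->
  measurable [set x : C | O (x t)].
Proof.
move=> oO; pose t' := Num.max 0 (Num.min t T).
have t'T : `[0, T]%classic t'.
  by rewrite /= in_itv/= /t' le_max lexx/= ge_max T0 ge_min lexx orbT.
apply: sub_sigma_algebra.
exists [set f : {uniform` `[0, T] -> 'cV[R]_d} | O (f t')]; last first.
  apply/seteqP; split => x /=; have [_ _ xE] := cpath_funP x.
    by rewrite [in X in _ -> X]xE.
  by rewrite [in X in X -> _]xE.
rewrite openE => f Of; apply/uniform_nbhs.
have : nbhs (f t') O by apply: open_nbhs_nbhs.
rewrite -nbhs_entourageE => -[E entE EO]; exists E; split => // h Eh.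
by apply: EO; apply/xsectionP; exact: Eh.
Qed.

Let disc (n : nat) (s : R) : R := (Num.floor (s * n.+1%:R))%:~R / n.+1%:R.

Let disc_cvg s : disc n s @[n --> \oo] --> s.
Proof.
apply/cvgrPdist_le => e e0; near=> n.
have n0 : 0 < n.+1%:R :> R by rewrite ltr0n.
have /andP[h1 h2] := floor_itv (s * n.+1%:R).
rewrite /disc; set z : R := (Num.floor _)%:~R in h1 *.
have -> : s - z / n.+1%:R = (s * n.+1%:R - z) / n.+1%:R by field; rewrite gt_eqF.
rewrite normrM [X in _ * X]gtr0_norm ?invr_gt0//.
apply: (@le_trans _ _ n.+1%:R^-1); last first.
  by apply: ltW; near: n; exact: (near_infty_natSinv_lt (PosNum e0)).
have z1 : `|s * n.+1%:R - z| <= 1.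
  by move: h2; rewrite ger0_norm ?subr_ge0// intrD -/z => h2; lra.
by rewrite ler_piMl// invr_ge0 ltW.
Unshelve. all: by end_near. Qed.

Let measurable_disc n (O : set 'cV[R]_d) : open O ->
  measurable [set p : R * C | O (p.2 (disc n p.1))].
Proof.
move=> oO.
rewrite [X in measurable X](_ : _ = \bigcup_(z : int)
  ([set s : R | Num.floor (s * n.+1%:R) = z] `*`
   [set x : C | O (x (z%:~R / n.+1%:R))])).
  apply: countable_bigcupT_measurable => // z; apply: measurableX; last first.
    exact: measurable_cpath_eval.
  rewrite [X in measurable X](_ : _ = (fun s => s * n.+1%:R) @^-1` `[z%:~R, (z + 1)%:~R[%classic).
    by rewrite -[X in measurable X]setTI; apply: measurable_funM.
  apply/seteqP; split => s /=; rewrite in_itv/=.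
    by move=> <-; exact: floor_itv.
  by move=> h; exact: floor_def.
apply/seteqP; split => [[s x] /= Ox|[s x] [z _ [/= <-]]] //.
by exists (Num.floor (s * n.+1%:R)).
Qed.

(** A path is the pointwise limit of its values at discretized times.  The
discretization has countably many values, so joint measurability reduces to that
of evaluations.  Membership of the limit in an open set O is expressed by
membership of almost all terms in the interior of one of the sets F k of points
that stay in O with a margin. *)
Lemma measurable_cpath_apply :
  measurable_fun setT (fun p : R * C => p.2 p.1).
Proof.
apply: (measurability (@open 'cV[R]_d)) => //.
move=> _ [] O oO <-; rewrite setTI.
pose F (k : nat) := [set v : 'cV[R]_d | forall y, ball v k.+1%:R^-1 y -> O y].
have oF k : open (interior (F k)) by exact: open_interior.
rewrite [X in measurable X](_ : _ = \bigcup_k \bigcup_N \bigcap_(n in [set n | (N <= n)%N])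
    [set p : R * C | interior (F k) (p.2 (disc n p.1))]).
  apply: bigcupT_measurable => k; apply: bigcupT_measurable => N.
  by apply: bigcap_measurable => [|n _]; [exists N => /=|exact: measurable_disc].
apply/seteqP; split => -[s x] /=.
- move=> Ox; have [cx _ _] := cpath_funP x.
  have xs : x (disc n s) @[n --> \oo] --> x s.
    by apply: continuous_cvg; [exact: cx|exact: disc_cvg].
  have : nbhs (x s) O by apply: open_nbhs_nbhs.
  move=> /nbhs_ballP[e /= e0 eO].
  have [k ke] : exists k : nat, k.+1%:R^-1 <= e / 2.
    have e20 : 0 < e / 2 by rewrite divr_gt0.
    have [k _ /(_ k (leqnn k))/ltW ke] := near_infty_natSinv_lt (PosNum e20).
    by exists k.
  have : nbhs (x s) (interior (F k)).
    apply: open_nbhs_nbhs; split => //; apply/nbhs_ballP; exists (e / 2) => /=.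
      by rewrite divr_gt0.
    move=> v xv y vy; apply: eO; apply: (ball_split xv).
    exact: le_ball vy.
  by move=> /xs[N _ HN]; exists k => //; exists N => // n /HN.
- move=> [k _ [N _ H]]; have [cx _ _] := cpath_funP x.
  have xs : x (disc n s) @[n --> \oo] --> x s.
    by apply: continuous_cvg; [exact: cx|exact: disc_cvg].
  have : nbhs (x s) (ball (x s) k.+1%:R^-1) by exact: nbhsx_ballx.
  move=> /xs[M _ HM].
  have := H (maxn N M) (leq_maxl _ _) => /interior_subset; apply.
  by apply: ball_sym; apply: HM => /=; exact: leq_maxr.
Qed.

Lemma measurable_along_cpath d' (U : measurableType d') (a : 'cV[R]_d -> R -> U) :
  measurable_fun (setT `*` `[0, T]) (fun p : 'cV[R]_d * R => a p.1 p.2) ->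
  measurable_fun (`[0, T] `*` setT) (fun p : R * C => a (p.2 p.1) p.1).
Proof.
move=> ma.
apply: (@measurable_comp _ _ _ _ _ _ (setT `*` `[0, T])
  (fun p : 'cV[R]_d * R => a p.1 p.2) _ (fun p : R * C => (p.2 p.1, p.1))) => //.
- exact: measurableX.
- by move=> _ [[s x] [/= sT _] <-].
- apply: measurable_funTS; apply/measurable_fun_pair => //.
  exact: measurable_cpath_apply.
Qed.

Lemma measurable_cpath_integral (a : 'cV[R]_d -> R -> \bar R) :
  measurable_fun (setT `*` `[0, T]) (fun p : 'cV[R]_d * R => a p.1 p.2) ->
  (forall x s, 0 <= a x s)%E ->
  measurable_fun setT (fun x : C =>
    (\int[lebesgue_measure]_(s in `[0%R, T]) a (x s) s)%E).
Proof.
move=> ma a0; apply: (@measurable_param_integral _ _ _ `[0, T]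
  (fun p : R * C => a (p.2 p.1) p.1)) => //.
exact: measurable_along_cpath.
Qed.

Lemma measurable_work (f : 'cV[R]_d -> R -> R) (g : 'cV[R]_d -> R) :
  measurable_fun (setT `*` `[0, T]) (fun p : 'cV[R]_d * R => f p.1 p.2) ->
  measurable_fun setT g ->
  measurable_fun setT (work f g : C -> R).
Proof.
move=> mf mg; apply: measurable_funD; last first.
  apply: (measurableT_comp mg); apply: (measurability (@open 'cV[R]_d)) => //.
  by move=> _ [] O oO <-; rewrite setTI; exact: measurable_cpath_eval.
apply: measurableT_comp => //.
have mf' : measurable_fun (setT `*` `[0, T]) (fun p : 'cV[R]_d * R => (f p.1 p.2)%:E).
  exact/measurable_EFinP.
rewrite (_ : (fun _ => _) = (fun x : C =>
   (\int[lebesgue_measure]_(s in `[0%R, T]) maxe (f (x s) s)%:E 0 -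
    \int[lebesgue_measure]_(s in `[0%R, T]) maxe (- (f (x s) s)%:E) 0)%E)); last first.
  apply/funext => x; rewrite integralE; congr (_ - _)%E; apply: eq_integral => s _.
    by rewrite funeposE.
  by rewrite funenegE.
apply: emeasurable_funB.
  apply: (@measurable_cpath_integral (fun x s => maxe (f x s)%:E 0)%E).
    by apply: measurable_maxe => //; exact: measurable_cst.
  by move=> x s; rewrite le_max lexx orbT.
apply: (@measurable_cpath_integral (fun x s => maxe (- (f x s)%:E) 0)%E).
  by apply: measurable_maxe => //; exact: measurableT_comp.
by move=> x s; rewrite le_max lexx orbT.
Qed.

End cpath_measurable.

(** * Densities and second moments *)

Section density_facts.
Context d (C : measurableType d) (R : realType).
Implicit Types mu nu : probability C R.

Lemma measurable_density nu mu : nu `<< mu -> measurable_fun setT (density nu mu).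
Proof.
move=> num; apply: measurableT_comp => //; exact: measurable_int (Radon_Nikodym_integrable num).
Qed.

Lemma densityE nu mu x : nu `<< mu ->
  (density nu mu x)%:E = Radon_Nikodym (charge_of_finite_measure nu) mu x.
Proof. by move=> num; rewrite /density fineK// Radon_Nikodym_fin_num. Qed.

Lemma density_SigmaFinite nu mu : nu `<< mu ->
  ae_eq mu setT (Radon_Nikodym_SigmaFinite.f nu mu) (EFin \o density nu mu).
Proof.
move=> num; have := ae_eq_Radon_Nikodym_SigmaFinite num measurableT.
by apply: filterS => x /= H Dx; rewrite densityE// H.
Qed.

Lemma density_ge0 nu mu : nu `<< mu -> {ae mu, forall x, 0 <= density nu mu x}.
Proof.
move=> num; apply: filterS (density_SigmaFinite num) => x /= /(_ I) H.
by rewrite -lee_fin -H; exact: Radon_Nikodym_SigmaFinite.f_ge0.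
Qed.

Lemma integral_density nu mu (f : C -> \bar R) : nu `<< mu ->
  measurable_fun setT f -> (forall x, 0 <= f x)%E ->
  (\int[nu]_x f x = \int[mu]_x (f x * (density nu mu x)%:E))%E.
Proof.
move=> num mf f0; rewrite -(Radon_Nikodym_SigmaFinite.change_of_variables num)//.
apply: ae_eq_integral => //.
- apply: emeasurable_funM => //.
  exact: measurable_int (Radon_Nikodym_SigmaFinite.f_integrable num).
- by apply: emeasurable_funM => //; apply/measurable_EFinP; exact: measurable_density.
by apply: filterS (density_SigmaFinite num) => x /= H Dx; rewrite H.
Qed.

Lemma density_unique nu mu (h : C -> \bar R) : nu `<< mu ->
  measurable_fun setT h ->
  (forall A, measurable A -> nu A = \int[mu]_(x in A) h x)%E ->
  {ae mu, forall x, (density nu mu x)%:E = h x}.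
Proof.
move=> num mh nuE.
have : ae_eq mu setT (Radon_Nikodym (charge_of_finite_measure nu) mu) h.
  apply: integral_ae_eq => //; first exact: Radon_Nikodym_integrable.
  by move=> E _ mE; rewrite -nuE// -Radon_Nikodym_integral.
by apply: filterS => x /(_ I) <-; rewrite densityE.
Qed.

(** The chain rule, applied to mu, nu and mu again. *)
Lemma density_inv nu mu : nu `<< mu -> mu `<< nu ->
  {ae mu, forall x, density mu nu x * density nu mu x = 1}.
Proof.
move=> num mun.
have H1 : {ae mu, forall x, (density mu mu x)%:E = 1%E}.
  apply: (@density_unique mu mu (cst 1%E)) => //.
  by move=> A mA; rewrite integral_cst// mul1e.
have H2 := @Radon_Nikodym_chain_rule _ _ _ (charge_of_finite_measure mu) mu nu mun num.
apply: filterS2 H1 H2 => x H1 /(_ I) H2; apply: EFin_inj.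
by rewrite EFinM !densityE// -H1 densityE.
Qed.

End density_facts.

Lemma ae_distribution d d' (Omega : measurableType d) (C : measurableType d')
    (R : realType) (P : probability Omega R) (X : {mfun Omega >-> C}) (Q : C -> Prop) :
  {ae distribution P X, forall x, Q x} -> {ae P, forall w, Q (X w)}.
Proof.
move=> [N [mN N0 sub]]; exists (X @^-1` N); split => //.
  by rewrite -[X in measurable X]setTI; exact: measurable_funPT.
by move=> w Qw; apply: sub.
Qed.

Section chi2.
Context d (C : measurableType d) (R : realType) (nu : probability C R).
Variables (L : C -> R) (Lam : C -> \bar R).
Hypotheses (mL : measurable_fun setT L) (mLam : measurable_fun setT Lam).
Hypothesis Lam0 : forall x, (0 <= Lam x)%E.
Local Open Scope ereal_scope.

(** Hoelder for the product of L^2 exp (- (2 p - 1) Lam) and exp ((2 p - 1) Lam).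
Where Lam is infinite its finite part is 0, which is harmless: there the
integrand on the right-hand side is +oo unless the exponent vanishes. *)
Lemma second_moment_hoelder (p q : R) : (0 < p)%R -> (0 < q)%R ->
  (p^-1 + q^-1 = 1)%R -> (0 <= q * (2 * p - 1))%R ->
  \int[nu]_x ((L x ^+ 2 * expR (- (2 * p - 1) * fine (Lam x))) `^ p)%:E <= 1 ->
  \int[nu]_x (L x ^+ 2)%:E <=
  (\int[nu]_x expeR ((q * (2 * p - 1))%:E * Lam x)) `^ q^-1.
Proof.
move=> p0 q0 pq c0 K1.
pose F1 x := (L x ^+ 2 * expR (- (2 * p - 1) * fine (Lam x)))%R.
pose F2 x := expR ((2 * p - 1) * fine (Lam x)).
have mlam : measurable_fun setT (fine \o Lam) by exact: measurableT_comp.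
have mF1 : measurable_fun setT F1.
  apply: measurable_funM; first exact: measurable_funX.
  by apply: measurableT_comp => //; exact: measurable_funM.
have mF2 : measurable_fun setT F2.
  by apply: measurableT_comp => //; exact: measurable_funM.
have F10 x : (0 <= F1 x)%R by rewrite mulr_ge0 ?sqr_ge0 ?expR_ge0.
have := hoelder nu mF1 mF2 p0 q0 pq.
rewrite Lnorm1 [X in X <= _ -> _](_ : _ = \int[nu]_x (L x ^+ 2)%:E); last first.
  apply: eq_integral => x _ /=; congr EFin.
  by rewrite /F1 /F2 -mulrA -expRD mulNr addNr expR0 mulr1 ger0_norm ?sqr_ge0.
move=> /le_trans; apply.
rewrite -[leRHS]mul1e; apply: lee_pmul; [exact: Lnorm_ge0..| |].
  rewrite unlock -(poweR1r p^-1); apply: gt0_ler_poweR.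
  - by rewrite invr_ge0 ltW.
  - by rewrite in_itv/= leey andbT integral_ge0// => x _; exact: poweR_ge0.
  - by rewrite in_itv/= leey andbT.
  apply: le_trans K1; rewrite le_eqVlt; apply/orP; left; apply/eqP.
  by apply: eq_integral => x _; rewrite poweR_EFin ger0_norm.
rewrite unlock; apply: gt0_ler_poweR.
- by rewrite invr_ge0 ltW.
- by rewrite in_itv/= leey andbT integral_ge0// => x _; exact: poweR_ge0.
- by rewrite in_itv/= leey andbT integral_ge0// => x _; exact: expeR_ge0.
rewrite [leLHS](_ : _ = \int[nu]_x (F2 x `^ q)%:E); last first.
  by apply: eq_integral => x _; rewrite poweR_EFin ger0_norm ?expR_ge0.
apply: ge0_le_integral => //.
- by move=> x _; rewrite lee_fin powR_ge0.
- apply/measurable_EFinP.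
  exact: (measurableT_comp (f := fun x => x `^ q)%R).
- apply: (measurableT_comp (@measurable_expeR R)).
  exact: measurable_funeM.
move=> x _; rewrite /F2 -expRM mulrC mulrA.
have := Lam0 x; case: (Lam x) => [l| |]//= l0.
rewrite mulr0 expR0; have [->|cn0] := eqVneq (q * (2 * p - 1))%R 0%R.
  by rewrite mul0e /= expR0.
by rewrite gt0_muley ?lte_fin ?lt_neqAle 1?eq_sym ?cn0//= leey.
Qed.

End chi2.

Section relative_variance.
Context d d' (Omega : measurableType d) (C : measurableType d') (R : realType)
  (P : probability Omega R) (X : {mfun Omega >-> C}).
Local Open Scope ereal_scope.

(** Integrating (L - 1)^2 + 2 L = L^2 + 1 involves nonnegative functions only, so
the identity also covers an infinite second moment. *)
Lemma second_moment_variance (nu : probability C R) (L : C -> R) :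
  measurable_fun setT L -> (forall x, 0 <= L x)%R ->
  \int[nu]_x (L x)%:E = 1 ->
  \int[nu]_x ((L x - 1) ^+ 2)%:E + 1 = \int[nu]_x (L x ^+ 2)%:E.
Proof.
move=> mL L0 L1.
have m1 : measurable_fun setT (fun x => ((L x - 1) ^+ 2)%:E).
  by apply/measurable_EFinP; apply: measurable_funX; exact: measurable_funB.
have m2 : measurable_fun setT (fun x => (L x ^+ 2)%:E).
  by apply/measurable_EFinP; exact: measurable_funX.
have mL' : measurable_fun setT (fun x => (L x)%:E) by exact/measurable_EFinP.
have e1 : \int[nu]_x (((L x - 1) ^+ 2)%:E + ((L x)%:E + (L x)%:E)) =
    \int[nu]_x ((L x ^+ 2)%:E + 1).
  apply: eq_integral => x _; rewrite -!EFinD; congr EFin; ring.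
move: e1; rewrite ge0_integralD//; last 3 first.
- by move=> x _; rewrite lee_fin sqr_ge0.
- by move=> x _; rewrite adde_ge0// lee_fin.
- exact: emeasurable_funD.
rewrite ge0_integralD//; [|by move=> x _; rewrite lee_fin..].
rewrite [RHS]ge0_integralD//; last by move=> x _; rewrite lee_fin sqr_ge0.
rewrite L1 integral_cst//= probability_setT mule1 addeA => e1.
by have := congr1 (fun z => z - 1) e1; rewrite !addeK.
Qed.

(** A real-valued version Y of a density may be negative on a null set; its
positive part is used wherever a nonnegative integrand is wanted. *)
Lemma relative_sd_le (Y : C -> R) (m : R) (B : \bar R) :
  measurable_fun setT Y -> {ae distribution P X, forall x, 0 <= Y x}%R -> (0 < m)%R ->
  \int[distribution P X]_x (Num.max (Y x) 0)%:E = m%:E ->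
  \int[distribution P X]_x ((Num.max (Y x) 0 / m) ^+ 2)%:E <= B ->
  (m^-1)%:E * sqrte 'V_P[Y \o X] <= (B - 1) `^ 2^-1.
Proof.
move=> mY Y0 m0 Ym SB; set nu := distribution P X in Y0 Ym SB.
have mX : measurable_fun setT X by [].
pose L x := (Num.max (Y x) 0 / m)%R.
have mYp : measurable_fun setT (fun x => Num.max (Y x) 0%R) by exact: measurable_maxr.
have mL : measurable_fun setT L by exact: measurable_funM.
have L0 x : (0 <= L x)%R by apply: divr_ge0; [rewrite le_max lexx orbT|exact: ltW].
have Yp0 x : 0 <= (Num.max (Y x) 0%R)%:E by rewrite lee_fin le_max lexx orbT.
have L1 : \int[nu]_x (L x)%:E = 1.
  under eq_integral do rewrite /L mulrC EFinM.
  rewrite ge0_integralZl//; [|exact/measurable_EFinP|by rewrite lee_fin invr_ge0 ltW].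
  by rewrite Ym -EFinM mulVf// gt_eqF.
have EY : 'E_P[Y \o X] = m%:E.
  rewrite unlock -Ym /nu /distribution ge0_integral_pushforward//; last exact/measurable_EFinP.
  apply: ae_eq_integral => //.
  - by apply/measurable_EFinP; exact: measurableT_comp.
  - by apply/measurable_EFinP; exact: (measurableT_comp mYp).
  by apply: filterS (ae_distribution Y0) => w Yw _ /=; rewrite (max_idPl Yw).
have -> : 'V_P[Y \o X] = (m ^+ 2)%:E * \int[nu]_x ((L x - 1) ^+ 2)%:E.
  rewrite /variance covariance.unlock EY/= expectation.unlock.
  rewrite /nu /distribution ge0_integral_pushforward//=; last 2 first.
  - by apply/measurable_EFinP; apply: measurable_funX; exact: measurable_funB.
  - by move=> x _; rewrite lee_fin sqr_ge0.
  rewrite preimage_setT -ge0_integralZl//; last 3 first.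
  - apply: (measurableT_comp (f := fun x => ((L x - 1) ^+ 2)%:E)) => //.
    by apply/measurable_EFinP; apply: measurable_funX; exact: measurable_funB.
  - by move=> x _; rewrite lee_fin sqr_ge0.
  - by rewrite lee_fin sqr_ge0.
  apply: ae_eq_integral => //.
  - apply/measurable_EFinP; apply: measurable_funM; apply: measurable_funB => //;
      exact: measurableT_comp.
  - apply: emeasurable_funM => //.
    apply: (measurableT_comp (f := fun x => ((L x - 1) ^+ 2)%:E)) => //.
    by apply/measurable_EFinP; apply: measurable_funX; exact: measurable_funB.
  apply: filterS (ae_distribution Y0) => w Yw _ /=.
  rewrite -EFinM /L (max_idPl Yw); congr EFin.
  rewrite -[LHS]/((Y (X w) - m) * (Y (X w) - m))%R; field; by rewrite gt_eqF.
set M := \int[nu]_x _.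
have M0 : 0 <= M by apply: integral_ge0 => x _; rewrite lee_fin sqr_ge0.
have MS := second_moment_variance mL L0 L1; rewrite -/M in MS.
have MB : M <= B - 1.
  by rewrite leeBrDr// MS.
rewrite sqrteM ?lee_fin ?sqr_ge0// EFin_expe sqrte_sqr.
rewrite gee0_abs; last by rewrite lee_fin ltW.
rewrite muleA -EFinM mulVf ?gt_eqF// mul1e.
rewrite poweR12_sqrt; last exact: le_trans MB.
by rewrite lee_sqrt// (le_trans M0).
Qed.

End relative_variance.

(** * Girsanov densities along the uncontrolled path *)

Section energy.
Context {R : realType} {n : nat} (T : R).

Lemma sqnorm_affine (a b : R) (u v : 'cV[R]_n) : a + b = 1 ->
  sqnorm (a *: u + b *: v) = a * sqnorm u + b * sqnorm v - a * b * sqnorm (v - u).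
Proof.
move=> ab; rewrite /sqnorm !mulr_sumr -big_split/= -sumrB.
apply: eq_bigr => i _; rewrite !mxE.
have -> : b = 1 - a by rewrite -ab addrC addKr.
ring.
Qed.

Let I : set (measurableTypeR R) := `[0, T].
Let mI : measurable I. Proof. exact: measurable_itv. Qed.

Lemma measurable_sqnorm_col (V : R -> 'cV[R]_n) :
  (forall i, measurable_fun I (fun s => V s i 0)) ->
  measurable_fun I (fun s => sqnorm (V s)).
Proof. by move=> mV; apply: measurable_sum => i; exact: measurable_funX. Qed.

Variables (U V : R -> 'cV[R]_n).
Hypothesis mU : forall i, measurable_fun I (fun s => U s i 0).
Hypothesis mV : forall i, measurable_fun I (fun s => V s i 0).
Hypothesis Ufin : (\int[lebesgue_measure]_(s in I) (sqnorm (U s))%:E < +oo)%E.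
Hypothesis Vfin : (\int[lebesgue_measure]_(s in I) (sqnorm (V s))%:E < +oo)%E.

Let sq_integrable (f : R -> 'cV[R]_n) :
  (forall i, measurable_fun I (fun s => f s i 0)) ->
  (\int[lebesgue_measure]_(s in I) (sqnorm (f s))%:E < +oo)%E ->
  lebesgue_measure.-integrable I (EFin \o (fun s => sqnorm (f s))).
Proof.
move=> mf fi; apply/integrableP; split.
  by apply/measurable_EFinP; exact: measurable_sqnorm_col.
by under eq_integral do rewrite /= ger0_norm ?sqnorm_ge0//.
Qed.

Lemma energy_sub_lty :
  (\int[lebesgue_measure]_(s in I) (sqnorm (V s - U s)%R)%:E < +oo)%E.
Proof.
have i2 : lebesgue_measure.-integrable I
    (fun s => (2%:E * (sqnorm (U s))%:E + 2%:E * (sqnorm (V s))%:E)%E).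
  by apply: integrableD => //; apply: integrableZl => //; exact: sq_integrable.
have ilt := integrable_lty mI i2.
apply: (le_lt_trans _ ilt); apply: ge0_le_integral => //.
- by move=> s _; rewrite lee_fin sqnorm_ge0.
- apply/measurable_EFinP; apply: measurable_sqnorm_col => i.
  rewrite (_ : (fun _ => _) = (fun s => V s i 0 - U s i 0)); first exact: measurable_funB.
  by apply/funext => s; rewrite !mxE.
- exact: measurable_int i2.
move=> s _; rewrite -!EFinM -EFinD lee_fin /sqnorm !mulr_sumr -big_split/=.
apply: ler_sum => i _; rewrite !mxE.
by have := sqr_ge0 (U s i 0 + V s i 0); nra.
Qed.

(** All three integrals are finite, so the pointwise identity sqnorm_affine can be
integrated term by term although a * b may have any sign. *)
Lemma energy_affine (a b : R) : a + b = 1 ->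
  (\int[lebesgue_measure]_(s in I) (sqnorm (a *: U s + b *: V s))%:E =
   (a * (\int[lebesgue_measure]_(s in I) sqnorm (U s)) +
    b * (\int[lebesgue_measure]_(s in I) sqnorm (V s)) -
    a * b * (\int[lebesgue_measure]_(s in I) sqnorm (V s - U s)))%R%:E)%E.
Proof.
move=> ab.
have iU := sq_integrable mU Ufin; have iV := sq_integrable mV Vfin.
have mVU i : measurable_fun I (fun s => (V s - U s) i 0).
  rewrite (_ : (fun _ => _) = (fun s => V s i 0 - U s i 0)); first exact: measurable_funB.
  by apply/funext => s; rewrite !mxE.
have iVU := sq_integrable mVU energy_sub_lty.
have Z (c : R) (f : R -> R) : lebesgue_measure.-integrable I (EFin \o f) ->
    lebesgue_measure.-integrable I (fun s => (c * f s)%:E).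
  by move=> fi; apply: (integrableZl _ c fi).
under eq_integral do rewrite sqnorm_affine// EFinB EFinD.
rewrite integralB//; [|by apply: integrableD => //; exact: Z|exact: Z].
rewrite integralD//; [|exact: Z..].
have RI (c : R) (f : R -> R) : lebesgue_measure.-integrable I (EFin \o f) ->
    (\int[lebesgue_measure]_(s in I) (c * f s)%:E =
     (c * (\int[lebesgue_measure]_(s in I) f s))%R%:E)%E.
  move=> fi; under eq_integral do rewrite EFinM.
  rewrite integralZl// EFinM; congr (_ * _)%E.
  by rewrite /Rintegral fineK//; exact: integrable_fin_num.
by rewrite !RI// -!EFinD.
Qed.

End energy.

Section girsanov.
Context {dO : measure_display} {Omega : measurableType dO} {R : realType}
  (P : probability Omega R) {d : nat} (T : R) (x0 : 'cV[R]_d)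
  (b : 'cV[R]_d -> R -> 'cV[R]_d) (sigma : 'cV[R]_d -> R -> 'M[R]_d)
  (W : R -> Omega -> 'cV[R]_d).
Hypothesis sigma_unit : forall x s, 0 <= s <= T -> sigma x s \in unitmx.
Variable X : {mfun Omega >-> cpath T x0}.

(** The drift part of the integral against dX cancels the drift correction of
Girsanov's formula, leaving an integral against the Brownian motion. *)
Lemma girsanov_exponential (u : 'cV[R]_d -> R -> 'cV[R]_d)
    (Xu : {mfun Omega >-> cpath T x0}) :
  girsanov_density P b sigma W u X Xu ->
  exists2 J : Omega -> R,
    ito_integral P W T
      (fun s w => (u (X w s) s)^T *m invmx (sigma (X w s) s) *m sigma (X w s) s) J &
    {ae P, forall w, density (distribution P Xu) (distribution P X) (X w) =
      expR (J w - 2^-1 * (\int[lebesgue_measure]_(s in `[0, T])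
             sqnorm (u (X w s) s)))}.
Proof.
move=> [I [_ [J HJ IJ]] D]; exists J => //.
apply: filterS2 IJ D => w -> ->; congr (expR (_ - _)).
rewrite [X in X + _ - _](_ : _ = \int[lebesgue_measure]_(s in `[0, T])
   ((invmx (sigma (X w s) s) *m b (X w s) s)^T *m u (X w s) s) 0 0).
  by rewrite addrAC subrr add0r.
apply: eq_Rintegral => s _.
by rewrite -[in RHS](trmxK (u _ _)) -trmx_mul [RHS]mxE mulmxA.
Qed.

Lemma sigma_cancel (u : 'cV[R]_d -> R -> 'cV[R]_d) x s : 0 <= s <= T ->
  (u x s)^T *m invmx (sigma x s) *m sigma x s = (u x s)^T.
Proof. by move=> sT; rewrite mulmxKV// sigma_unit. Qed.

End girsanov.

Section tilted.
Context {dO : measure_display} {Omega : measurableType dO} {R : realType}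
  (P : probability Omega R) {d : nat} (T : R) (x0 : 'cV[R]_d)
  (b : 'cV[R]_d -> R -> 'cV[R]_d) (sigma : 'cV[R]_d -> R -> 'M[R]_d)
  (W : R -> Omega -> 'cV[R]_d) (X : {mfun Omega >-> cpath T x0}).
Hypothesis BM : brownian_motion P T W.
Hypothesis T0 : 0 <= T.
Hypothesis sigma_unit : forall x s, 0 <= s <= T -> sigma x s \in unitmx.

Definition control_distance (u v : 'cV[R]_d -> R -> 'cV[R]_d) (x : cpath T x0) : \bar R :=
  (\int[lebesgue_measure]_(s in `[0%R, T]) (sqnorm (v (x s) s - u (x s) s)%R)%:E)%E.

Lemma measurable_control_distance u v :
  measurable_coef T u -> measurable_coef T v ->
  measurable_fun setT (control_distance u v).
Proof.
move=> mu mv; apply: (measurable_cpath_integral T0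
  (a := fun x s => (sqnorm (v x s - u x s))%:E)); last first.
  by move=> x s; rewrite lee_fin sqnorm_ge0.
apply/measurable_EFinP; apply: measurable_sum => i; apply: measurable_funX.
rewrite (_ : (fun _ => _) = (fun p : 'cV[R]_d * R => v p.1 p.2 i 0 - u p.1 p.2 i 0)).
  by apply: measurable_funB; exact: (measurableT_comp (measurable_mx_coord _ _)).
by apply/funext => p; rewrite !mxE.
Qed.

Let measurable_control_path (u : 'cV[R]_d -> R -> 'cV[R]_d) w (i : 'I_d) : measurable_coef T u ->
  measurable_fun (`[0, T] : set (measurableTypeR R)) (fun s => u (X w s) s i 0).
Proof.
move=> mu; have := measurable_along_cpath (x0 := x0) T0 mu => mu'.
apply: (measurableT_comp (measurable_mx_coord i 0)).
exact: (measurable_section (X w) _ mu').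
Qed.

(** Along X the logarithms of the two densities are Ju - |u|^2 / 2 and
Jv - |v|^2 / 2 (integrated), and the last term of the exponent corrects the
quadratic part to that of the control al u + be v: the integrand is the
stochastic exponential of this control. *)
Lemma tilted_moment_le1 (u v : 'cV[R]_d -> R -> 'cV[R]_d)
    (Xu Xv : {mfun Omega >-> cpath T x0}) (al be : R) : al + be = 1 ->
  measurable_coef T u -> measurable_coef T v ->
  distribution P Xu `<< distribution P X -> distribution P Xv `<< distribution P X ->
  girsanov_density P b sigma W u X Xu -> girsanov_density P b sigma W v X Xv ->
  (\int[P]_w (expR (al * ln (density (distribution P Xu) (distribution P X) (X w)) +
      be * ln (density (distribution P Xv) (distribution P X) (X w)) +
      2^-1 * (al * be * fine (control_distance u v (X w)))))%:E <= 1)%E.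
Proof.
move=> ab mu mv numu numv gu gv.
have [Ju HJu Du] := girsanov_exponential gu.
have [Jv HJv Dv] := girsanov_exponential gv.
apply: le_trans (ito_exponential_le1 BM T0 al be HJu HJv).
rewrite le_eqVlt; apply/orP; left; apply/eqP; apply: ae_eq_integral => //.
- apply/measurable_EFinP; apply: measurableT_comp => //.
  have mln (Y : {mfun Omega >-> cpath T x0}) : distribution P Y `<< distribution P X ->
      measurable_fun setT (fun w => ln (density (distribution P Y) (distribution P X) (X w))).
    move=> h; apply: measurableT_comp => //; apply: measurableT_comp => //.
    exact: measurable_density.
  apply: measurable_funD.
    by apply: measurable_funD; apply: measurable_funM => //; exact: mln.
  apply: measurable_funM => //; apply: measurable_funM => //.
  apply: measurableT_comp => //; apply: measurableT_comp => //.
  exact: measurable_control_distance.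
- exact: (measurable_ito_exponential _ _ HJu HJv).
have Eu := ito_integrand_sq_lty BM T0 HJu.
have Ev := ito_integrand_sq_lty BM T0 HJv.
have Hsig (w : Omega) (c : 'cV[R]_d -> R -> 'cV[R]_d) s : s \in `[0, T] ->
   ((c (X w s) s)^T *m invmx (sigma (X w s) s) *m sigma (X w s) s)^T = c (X w s) s.
  by rewrite in_itv/= => sT; rewrite (sigma_cancel sigma_unit)// trmxK.
apply: filterS2 (filterI Du Dv) (filterI Eu Ev) => w [-> ->] [Eu' Ev'] _.
have {}Eu' : (\int[lebesgue_measure]_(s in `[0%R, T]) (sqnorm (u (X w s) s))%:E < +oo)%E.
  by apply: le_lt_trans Eu'; rewrite le_eqVlt; apply/orP; left; apply/eqP;
    apply: eq_integral => s /[!inE] sT; rewrite Hsig.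
have {}Ev' : (\int[lebesgue_measure]_(s in `[0%R, T]) (sqnorm (v (X w s) s))%:E < +oo)%E.
  by apply: le_lt_trans Ev'; rewrite le_eqVlt; apply/orP; left; apply/eqP;
    apply: eq_integral => s /[!inE] sT; rewrite Hsig.
rewrite (_ : (\int[lebesgue_measure]_(s in `[0%R, T]) _)%E =
  (\int[lebesgue_measure]_(s in `[0%R, T])
     (sqnorm (al *: u (X w s) s + be *: v (X w s) s))%:E)%E); last first.
  apply: eq_integral => s /[!inE] sT.
  by rewrite linearD/= !linearZ/= !Hsig.
rewrite energy_affine//; [|by move=> i; exact: measurable_control_path..].
rewrite -EFinM -EFinB !expRK /=; congr (expR _)%:E.
rewrite /control_distance -/(Rintegral _ _ _).
set A := Rintegral _ _ _; set B := Rintegral _ _ _; set C := Rintegral _ _ _.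
by rewrite /Rintegral in C *; ring.
Qed.

End tilted.

(** * The relative error *)

Section exponents.
Context {R : realType}.
Let r2 : R := Num.sqrt 2.

Let r2_gt0 : 0 < r2. Proof. by rewrite sqrtr_gt0. Qed.
Let r2_sqr : r2 * r2 = 2. Proof. by rewrite -expr2 sqr_sqrtr. Qed.

(** These are the exponents p and q for which q (2 p - 1) is least. *)
Lemma conjugate_exponents : [/\ 0 < 1 + r2^-1 :> R, 0 < 1 + r2,
  (1 + r2^-1)^-1 + (1 + r2)^-1 = 1 &
  (1 + r2) * (2 * (1 + r2^-1) - 1) = (1 + r2) ^+ 2].
Proof.
have i0 : 0 < r2^-1 by rewrite invr_gt0.
have r20 : r2 != 0 by rewrite gt_eqF.
have e : 2 * r2^-1 = r2 by rewrite -r2_sqr mulfK.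
split; [exact: addr_gt0..| |].
  have -> : 1 + r2^-1 = (1 + r2) / r2 by field.
  by rewrite invf_div -[X in _ + X]mul1r -mulrDl addrC divff// gt_eqF// addr_gt0.
by rewrite expr2; congr (_ * _); rewrite mulrDr e mulr1; ring.
Qed.

End exponents.

Section relative_error.
Context {dO : measure_display} {Omega : measurableType dO} {R : realType}
  (P : probability Omega R) {d : nat} (T : R) (x0 : 'cV[R]_d)
  (f : 'cV[R]_d -> R -> R) (g : 'cV[R]_d -> R).
Hypothesis T0 : 0 <= T.
Hypothesis mf : measurable_fun (setT `*` `[0, T]) (fun p : 'cV[R]_d * R => f p.1 p.2).
Hypothesis mg : measurable_fun setT g.
Variables X Xu Xs : {mfun Omega >-> cpath T x0}.
Hypothesis Zfin : (partition_function P f g X < +oo)%E.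
Hypothesis opt : optimal P f g X Xs.

Let mu : probability (cpath T x0) R := distribution P X.
Let nu : probability (cpath T x0) R := distribution P Xu.
Let rho : probability (cpath T x0) R := distribution P Xs.
Let m := fine (partition_function P f g X).
Let e (x : cpath T x0) := expR (- work f g x).

Let me : measurable_fun setT e.
Proof.
by apply: measurableT_comp => //; apply: measurableT_comp => //; exact: measurable_work.
Qed.

Let partitionE : partition_function P f g X = (\int[mu]_x (e x)%:E)%E.
Proof.
rewrite /partition_function expectation.unlock /mu /distribution ge0_integral_pushforward//.
  exact/measurable_EFinP.
by move=> x _; rewrite lee_fin expR_ge0.
Qed.

Let mE : (\int[mu]_x (e x)%:E)%E = m%:E.
Proof.
rewrite -partitionE /m fineK// ge0_fin_numE// partitionE.
by apply: integral_ge0 => x _; rewrite lee_fin expR_ge0.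
Qed.

(** If Z were 0, division by Z would make the optimal law the zero measure. *)
Lemma partition_function_gt0 : 0 < m.
Proof.
have m0 : 0 <= m.
  by rewrite -lee_fin -mE; apply: integral_ge0 => x _; rewrite lee_fin expR_ge0.
rewrite lt_neqAle m0 andbT eq_sym; apply/eqP => mz.
have := opt measurableT; rewrite probability_setT -/m mz.
under eq_integral do rewrite invr0 mulr0.
by rewrite integral0 => /eqP; rewrite onee_eq0.
Qed.

Hypotheses (numu : nu `<< mu) (munu : mu `<< nu) (rhomu : rho `<< mu).

Let Y x := e x * density mu nu x.

Let mY : measurable_fun setT Y.
Proof. by apply: measurable_funM => //; exact: measurable_density. Qed.

Let Y_ge0 : {ae nu, forall x, 0 <= Y x}.
Proof. by apply: filterS (density_ge0 munu) => x D0; rewrite mulr_ge0// expR_ge0. Qed.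

Let integral_Y : (\int[nu]_x (Num.max (Y x) 0)%:E = m%:E)%E.
Proof.
rewrite -mE (integral_density munu)//; last 2 first.
- exact/measurable_EFinP.
- by move=> x; rewrite lee_fin expR_ge0.
apply: ae_eq_integral => //.
- by apply/measurable_EFinP; exact: measurable_maxr.
- by apply: emeasurable_funM; apply/measurable_EFinP => //; exact: measurable_density.
by apply: filterS Y_ge0 => x Yx _; rewrite (max_idPl Yx) -EFinM.
Qed.

Let opt_density : {ae mu, forall x, density rho mu x = e x / m}.
Proof.
have mh : measurable_fun setT (fun x => (e x / m)%:E).
  by apply/measurable_EFinP; exact: measurable_funM.
have H := density_unique rhomu mh opt.
by apply: filterS H => x h; exact: EFin_inj h.
Qed.

Variable Lam : cpath T x0 -> \bar R.
Hypotheses (mLam : measurable_fun setT Lam) (Lam0 : forall x, (0 <= Lam x)%E).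
Hypothesis density_pos : {ae P, forall w,
  0 < density nu mu (X w) /\ 0 < density rho mu (X w)}.
Hypothesis tilted : forall al be, al + be = 1 ->
  (\int[P]_w (expR (al * ln (density nu mu (X w)) + be * ln (density rho mu (X w)) +
      2^-1 * (al * be * fine (Lam (X w)))))%:E <= 1)%E.

Let m_gt0 := partition_function_gt0.

Let L x := Num.max (Y x) 0 / m.

Let mL : measurable_fun setT L.
Proof. by apply: measurable_funM => //; exact: measurable_maxr. Qed.

Let L_ge0 x : 0 <= L x.
Proof. by apply: divr_ge0; [rewrite le_max lexx orbT|exact: ltW]. Qed.

Let K (p : R) x := (L x ^+ 2 * expR (- (2 * p - 1) * fine (Lam x))) `^ p.

Let mK p : measurable_fun setT (K p).
Proof.
apply: (measurableT_comp (f := fun z => z `^ p)) => //.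
apply: measurable_funM; first exact: measurable_funX.
by apply: measurableT_comp => //; apply: measurable_funM => //; exact: measurableT_comp.
Qed.

(** Multiplying by dnu/dmu transports the integral to the uncontrolled path, where
L is the quotient of the two densities; the exponents of these densities become
2 p and 1 - 2 p. *)
Let integral_K p : (\int[nu]_x (K p x)%:E <= 1)%E.
Proof.
have ab : (1 - 2 * p) + 2 * p = 1 by rewrite subrK.
apply: le_trans (tilted ab); rewrite le_eqVlt; apply/orP; left; apply/eqP.
rewrite (integral_density numu)//; last 2 first.
- exact/measurable_EFinP.
- by move=> x; rewrite lee_fin powR_ge0.
have mD : measurable_fun setT (density nu mu) by exact: measurable_density.
have mD' : measurable_fun setT (density rho mu) by exact: measurable_density.
have mDp : measurable_fun setT (fun x => Num.max (density nu mu x) 0).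
  exact: measurable_maxr.
transitivity (\int[mu]_x (K p x * Num.max (density nu mu x) 0)%:E)%E.
  apply: ae_eq_integral => //.
  - by apply: emeasurable_funM; exact/measurable_EFinP.
  - by apply/measurable_EFinP; exact: measurable_funM.
  by apply: filterS (density_ge0 numu) => x D0 _; rewrite (max_idPl D0) EFinM.
rewrite /mu /distribution ge0_integral_pushforward//; last 2 first.
- by apply/measurable_EFinP; exact: measurable_funM.
- by move=> x _; rewrite lee_fin mulr_ge0 ?powR_ge0// le_max lexx orbT.
rewrite preimage_setT; apply: ae_eq_integral => //.
- apply: (measurableT_comp (f := fun x => (K p x * Num.max (density nu mu x) 0)%:E)) => //.
  by apply/measurable_EFinP; exact: measurable_funM.
- apply/measurable_EFinP; apply: measurableT_comp => //; apply: measurable_funD.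
    by apply: measurable_funD; apply: measurable_funM => //; apply: measurableT_comp => //;
      apply: measurableT_comp.
  apply: measurable_funM => //; apply: measurable_funM => //.
  by apply: measurableT_comp => //; exact: measurableT_comp.
have Hinv := ae_distribution (density_inv numu munu).
have Hopt := ae_distribution opt_density.
apply: filterS2 density_pos (filterI Hinv Hopt) => w [D0 D'0] [inv optw] _ /=.
congr EFin; rewrite (max_idPl (ltW D0)).
set D := density nu mu (X w) in D0 inv *; set D' := density rho mu (X w) in D'0 optw *.
have LE : L (X w) = expR (ln D' - ln D).
  rewrite expRB !lnK ?posrE// /L /Y.
  have -> : density mu nu (X w) = D^-1.
    by apply: (mulIf (lt0r_neq0 D0)); rewrite inv mulVf// lt0r_neq0.
  rewrite (max_idPl _); last by rewrite mulr_ge0 ?expR_ge0// invr_ge0 ltW.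
  by rewrite optw mulrAC.
rewrite /K LE -expRM_natl -expRD -expRM -[in X in _ * X = _](lnK D0) -expRD.
by congr expR; field.
Qed.

Lemma relative_error_le : (relative_error P f g X Xu <=
   ((\int[P]_w expeR (((1 + Num.sqrt 2) ^+ 2)%:E * Lam (Xu w)))
      `^ (1 + Num.sqrt 2)^-1 - 1) `^ 2^-1)%E.
Proof.
have [p0 q0 pq c] := @conjugate_exponents R.
have -> : (\int[P]_w expeR (((1 + Num.sqrt 2) ^+ 2)%:E * Lam (Xu w)) =
    \int[nu]_x expeR (((1 + Num.sqrt 2) ^+ 2)%:E * Lam x))%E.
  rewrite /nu /distribution ge0_integral_pushforward//.
    by apply: (measurableT_comp (@measurable_expeR R)); exact: measurable_funeM.
  by move=> x _; exact: expeR_ge0.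
apply: (relative_sd_le mY Y_ge0 m_gt0 integral_Y).
have H := second_moment_hoelder mL mLam Lam0 p0 q0 pq _ (integral_K _).
by rewrite c in H; apply: H; exact: sqr_ge0.
Qed.

End relative_error.

Theorem proposition3p8 (dO : measure_display) (Omega : measurableType dO)
    (R : realType) (P : probability Omega R) (d : nat) (T : R)
    (x0 : 'cV[R]_d) (b : 'cV[R]_d -> R -> 'cV[R]_d)
    (sigma : 'cV[R]_d -> R -> 'M[R]_d) (f : 'cV[R]_d -> R -> R)
    (g : 'cV[R]_d -> R) (W : R -> Omega -> 'cV[R]_d)
    (X Xu Xs : {mfun Omega >-> cpath T x0})
    (u us : 'cV[R]_d -> R -> 'cV[R]_d) :
  0 < T ->
  measurable_coef T b -> measurable_coef T sigma ->
  measurable_fun (setT `*` `[0, T]) (fun p : 'cV[R]_d * R => f p.1 p.2) ->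
  measurable_fun setT g ->
  (forall x s, 0 <= s <= T -> sigma x s \in unitmx) ->
  brownian_motion P T W ->
  unique_strong_solution P T x0 sigma W b ->
  strong_solution P sigma W b X ->
  (partition_function P f g X < +oo)%E ->
  admissible P b sigma W X u ->
  strong_solution P sigma W (controlled_drift b sigma u) Xu ->
  admissible P b sigma W X us ->
  strong_solution P sigma W (controlled_drift b sigma us) Xs ->
  optimal P f g X Xs ->
  (relative_error P f g X Xu <=
   ((\int[P]_w expeR (((1 + Num.sqrt 2) ^+ 2)%:E *
       \int[lebesgue_measure]_(s in `[0%R, T])
         (sqnorm (us (Xu w s) s - u (Xu w s) s)%R)%:E))
      `^ (1 + Num.sqrt 2)^-1 - 1) `^ 2^-1)%E.
Proof.
move=> T0 _ _ mf mg sigma_unit BM _ _ Zfin [mu _ admu] solu [mus _ adms] sols opt.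
have [numu munu gu] := admu _ solu; have [rhomu _ gs] := adms _ sols.
apply: (relative_error_le (ltW T0) mf mg Zfin opt numu munu rhomu
  (Lam := control_distance u us)) => //.
- exact: (measurable_control_distance (ltW T0)).
- by move=> x; apply: integral_ge0 => s _; rewrite lee_fin sqnorm_ge0.
- have [Ju _ Du] := girsanov_exponential gu; have [Js _ Ds] := girsanov_exponential gs.
  by apply: filterS2 Du Ds => w -> ->; rewrite !expR_gt0.
- by move=> al be ab; exact: (tilted_moment_le1 BM (ltW T0) sigma_unit ab mu mus numu rhomu gu gs).
Qed.
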